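(* For any pair of positive integers $k,n$ with $n \geq k+2$, we have \[ \frac{1}{2}\log(n-k+1) \leq \mathrm{sinv}'_k(n) \leq \log n + 4k - 3 . \]
   Context: All logarithms are to base 2. A digraph has no loops and no parallel arcs but may contain digons (pairs of opposite arcs between the same two vertices). For a digraph $D$ and $X \subseteq V(D)$, inverting $X$ means reversing the direction of every arc of $D$ with both endvertices in $X$; for a family $(X_i)_{i\in I}$ of vertex subsets, $\mathrm{Inv}(D;(X_i)_{i\in I})$ denotes the digraph obtained by inverting the $X_i$ one after another (equivalently, reversing exactly those arcs whose two endvertices lie together in an odd number of the $X_i$). A digraph $D$ is $k$-arc-strong if for every partition $(V_1,V_2)$ of $V(D)$ into nonempty sets there are at least $k$ arcs with tail in $V_1$ and head in $V_2$. $\mathrm{sinv}'_k(D)$ is the minimum number of sets whose inversion transforms $D$ into a $k$-arc-strong digraph. A digraph is $2k$-edge-connected if its underlying undirected multigraph (obtained by forgetting arc orientations, so a digon yields two parallel edges) is $2k$-edge-connected. $\mathrm{sinv}'_k(n) = \max\{\mathrm{sinv}'_k(D) : D \text{ is a } 2k\text{-edge-connected digraph of order } n\}$. *)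

(* Defs.v *)
From Stdlib Require Import Reals.
From mathcomp Require Import all_boot.

Set Implicit Arguments.
Unset Strict Implicit.
Unset Printing Implicit Defensive.

(* A digraph of order n: vertex set 'I_n, arc relation D (D u v = arc u -> v).
   Loopless: irreflexive D.  No parallel arcs (automatic for a relation);
   digons allowed (D u v && D v u). *)
Definition loopless (n : nat) (D : rel 'I_n) : Prop := forall v, D v v = false.

Definition narcs (n : nat) (D : rel 'I_n) (A B : {set 'I_n}) : nat :=
  #|[set p : 'I_n * 'I_n | [&& D p.1 p.2, p.1 \in A & p.2 \in B]]|.

Definition inv_family (n : nat) (D : rel 'I_n) (Xs : seq {set 'I_n}) : rel 'I_n :=
  fun u v => if odd (count (fun X : {set 'I_n} => (u \in X) && (v \in X)) Xs) then D v u else D u v.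

Definition arc_strong (n k : nat) (D : rel 'I_n) : Prop :=
  forall V1 : {set 'I_n}, V1 != set0 -> ~: V1 != set0 -> k <= narcs D V1 (~: V1).

(* underlying undirected multigraph is m-edge-connected: every cut
   (V1, V2) with both sides nonempty is crossed by at least m edges
   (a digon contributes two parallel edges). *)
Definition edge_connected (n m : nat) (D : rel 'I_n) : Prop :=
  forall V1 : {set 'I_n}, V1 != set0 -> ~: V1 != set0 ->
    m <= narcs D V1 (~: V1) + narcs D (~: V1) V1.

Definition is_sinv_digraph (n k : nat) (D : rel 'I_n) (s : nat) : Prop :=
  (exists Xs : seq {set 'I_n}, size Xs = s /\ arc_strong k (inv_family D Xs)) /\
  (forall Xs : seq {set 'I_n}, arc_strong k (inv_family D Xs) -> s <= size Xs).

Definition is_sinv_order (k n s : nat) : Prop :=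
  (forall D : rel 'I_n, loopless D -> edge_connected (2 * k) D ->
     exists t, is_sinv_digraph k D t /\ t <= s) /\
  (exists D : rel 'I_n, loopless D /\ edge_connected (2 * k) D /\ is_sinv_digraph k D s).

Definition log2 (x : R) : R := Rdiv (ln x) (ln (IZR 2%Z)).

(* Main.v *)
Require Import Defs.
From Stdlib Require Import Reals Lra.
From mathcomp Require Import all_boot ssralg finalg zmodp matrix mxalgebra.
From mathcomp Require Import vector finfield boolp zify.

Set Implicit Arguments.
Unset Strict Implicit.
Unset Printing Implicit Defensive.

(* Upper bound.  Let H be the arcs of D outside digons, pruned to a minimal set
   that still gives a 2k-edge-connected multigraph together with the digons.
   Splitting off vertices of degree 2k (Lovasz) yields a multiset M of extra
   edges with d_M(X) <= d(X) - 2k for every cut and such that all degrees of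
   H + M are even; an Eulerian orientation of H + M restricts to an orientation
   of H which is k-arc-strong together with the digons.  It remains to find
   vectors x_v in F_2^s with x_u . x_v prescribed on the edges of H.  They are
   chosen one vertex at a time, keeping the vectors of the placed neighbours of
   every unplaced vertex independent.  By uncrossing, a tight set X meeting the
   remaining vertex set S minimally induces no edge of H in S, and as only 2k
   edges leave X, removing from S a vertex of least degree in X :&: S gives an
   order in which few vectors are forbidden at each step.

   Lower bound.  It suffices to treat k = 1: a vertex joined to all others by
   digons raises the required connectivity by one and contributes at most one
   to every in- and out-degree.  Take m sources and, for each ordered pair of
   them, a vertex dominated by both.  After the inversions that vertex is
   neither a source nor a sink, so the two sources lie in different subfamilies
   of the inverted sets; and a source of the digraph must lie in at least one of
   them.  Hence m + 1 <= 2^s, where m is the integer part of the square root of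
   the order. *)

(** * Cuts of edge lists *)

Lemma count_uniq_sub (I : eqType) (P : pred I) (r s : seq I) :
  uniq r -> {subset r <= s} -> count P r <= count P s.
Proof.
move=> ur /(leq_uniq_count ur)/count_subseqP[r' r's pr].
by rewrite (permP pr); exact: leq_count_subseq.
Qed.

Lemma count_enum (I : finType) (P : pred I) (B : {set I}) :
  count P (enum B) = #|[set x in B | P x]|.
Proof.
rewrite -size_filter cardE; apply/perm_size/uniq_perm => [||x].
- exact: filter_uniq (enum_uniq _).
- exact: enum_uniq.
- by rewrite mem_filter !mem_enum !inE andbC.
Qed.

Section Cuts.
Variable T : finType.
Implicit Types (X Y A B S : {set T}) (E F M : seq (T * T)) (e f : T * T).
Implicit Types (u v z : T) (K : nat).

(* A multigraph is a list of pairs: [cut] ignores the order of their entries,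
   [leaves] reads them as arcs. *)
Definition crosses X : pred (T * T) := fun e => (e.1 \in X) (+) (e.2 \in X).

Definition cut E X : nat := count (crosses X) E.

Definition joins X Y : pred (T * T) :=
  fun e => (e.1 \in X) && (e.2 \in Y) || (e.1 \in Y) && (e.2 \in X).

Definition leaves X : pred (T * T) := fun e => (e.1 \in X) && (e.2 \notin X).

Definition flip e : T * T := (e.2, e.1).

Lemma flipK : involutive flip.
Proof. by case. Qed.

Lemma crosses_flip X e : crosses X (flip e) = crosses X e.
Proof. exact: addbC. Qed.

Lemma leaves_flip X e : leaves X (flip e) = leaves (~: X) e.
Proof. by rewrite /leaves !inE negbK andbC. Qed.

Lemma crosses_meets X S e :
  e.1 \in S -> e.2 \in S -> crosses X e -> X :&: S != set0.
Proof.
move=> e1S e2S; rewrite /crosses.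
have [e1X _|_ /= e2X] := boolP (e.1 \in X); apply/set0Pn.
  by exists e.1; rewrite inE e1X.
by exists e.2; rewrite inE e2X.
Qed.

Lemma cut_cons e E X : cut (e :: E) X = crosses X e + cut E X.
Proof. by []. Qed.

Lemma cut_cat E1 E2 X : cut (E1 ++ E2) X = cut E1 X + cut E2 X.
Proof. exact: count_cat. Qed.

Lemma perm_cut E1 E2 X : perm_eq E1 E2 -> cut E1 X = cut E2 X.
Proof. by move=> /permP/(_ (crosses X)). Qed.

Lemma cutC E X : cut E (~: X) = cut E X.
Proof. by apply: eq_count => e; rewrite /crosses !inE addNb addbN negbK. Qed.

Lemma cut_leaves E X :
  cut E X = count (leaves X) E + count (leaves (~: X)) E.
Proof.
elim: E => // e E; rewrite cut_cons /= => ->; rewrite addnACA; congr (_ + _).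
by rewrite /crosses /leaves !inE; do 2!case: (_ \in X).
Qed.

Ltac edgewise E :=
  elim: E => [//|[? ?] E]; rewrite /cut /= /crosses /joins !inE /=;
  repeat match goal with |- context [?x \in ?Z] => case: (x \in Z) end;
  rewrite /=; lia.

Lemma cut_submod E X Y :
  cut E (X :&: Y) + cut E (X :|: Y) <= cut E X + cut E Y.
Proof. edgewise E. Qed.

Lemma cut_posimod E X Y :
  cut E (X :\: Y) + cut E (Y :\: X) <= cut E X + cut E Y.
Proof. edgewise E. Qed.

(* An edge joining [X :&: Y] to the outside of [X :|: Y] is counted twice on
   the right and not at all on the left. *)
Lemma cut_posimod_edge E X Y e : e \in E ->
    e.1 \in X :&: Y -> e.2 \notin X :|: Y ->
  cut E (X :\: Y) + cut E (Y :\: X) + 2 <= cut E X + cut E Y.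
Proof.
move=> /perm_to_rem eE; rewrite !inE negb_or => /andP[eX eY] /andP[enX enY].
have := cut_posimod (rem e E) X Y.
by rewrite !(perm_cut _ eE) !cut_cons /crosses !inE eX eY (negbTE enX)
  (negbTE enY) /=; lia.
Qed.

Lemma cutU E X Y : [disjoint X & Y] ->
  cut E (X :|: Y) + 2 * count (joins X Y) E = cut E X + cut E Y.
Proof.
move=> dXY; elim: E => // -[a b] E; rewrite /cut /= /crosses /joins !inE /=.
have := (disjointFr dXY (x := a), disjointFr dXY (x := b)).
case: (a \in X); case: (b \in X); case: (a \in Y); case: (b \in Y);
  by rewrite /=; case=> *; lia.
Qed.

Lemma odd_cutU E X Y : [disjoint X & Y] ->
  odd (cut E (X :|: Y)) = odd (cut E X) (+) odd (cut E Y).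
Proof.
by move=> /(cutU E) /(congr1 odd); rewrite mul2n oddD oddD odd_double addbF.
Qed.

Definition edges_in A E : bool :=
  all (fun e => [&& e.1 \in A, e.2 \in A & e.1 != e.2]) E.

Definition separates X A : bool :=
  (X :&: A != set0) && (A :\: X != set0).

Lemma separatesC X A : separates (~: X) A = separates X A.
Proof.
by rewrite /separates andbC !setDE setCK [A :&: X]setIC [~: X :&: A]setIC.
Qed.

Lemma separatesT X : separates X setT = (X != set0) && (~: X != set0).
Proof. by rewrite /separates setIT setTD. Qed.

Lemma separatesP X A : reflect
  ((exists2 a, a \in A & a \in X) /\ (exists2 b, b \in A & b \notin X))
  (separates X A).
Proof.
apply: (iffP andP) => [[/set0Pn[a /setIP[aX aA]] /set0Pn[b /setDP[bA bX]]]|].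
  by split; [exists a | exists b].
move=> [[a aA aX] [b bA bX]].
by split; apply/set0Pn; [exists a | exists b]; rewrite inE ?aX ?bX.
Qed.

Lemma separatesS X A B : A \subset B -> separates X A -> separates X B.
Proof.
move=> /subsetP AB /separatesP[[a /AB aB aX] [b /AB bB bX]].
by apply/separatesP; split; [exists a | exists b].
Qed.

Lemma separates_proper X A : X != set0 -> X \proper A -> separates X A.
Proof.
move=> /set0Pn[x xX] /properP[XA [a aA aX]]; apply/separatesP.
by split; [exists x => //; exact: (subsetP XA) | exists a].
Qed.

Lemma separates_card X A : separates X A -> 1 < #|A|.
Proof.
move=> /separatesP[[a aA aX] [b bA bX]]; apply/card_gt1P; exists a, b.
by split=> //; apply: contraNneq bX => <-.
Qed.

Lemma eq_cut_in A E X Y : edges_in A E -> X :&: A = Y :&: A ->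
  cut E X = cut E Y.
Proof.
move=> /allP EA /setP XY; apply: eq_in_count => e /EA /and3P[e1 e2 _].
by have := (XY e.1, XY e.2); rewrite /crosses !inE e1 e2 !andbT => -[-> ->].
Qed.

Lemma cut_set0 E : cut E set0 = 0.
Proof. by elim: E => // e E IH; rewrite cut_cons IH /crosses !inE. Qed.

Lemma cut_not_separated A E X : edges_in A E -> ~~ separates X A ->
  cut E X = 0.
Proof.
move=> EA; rewrite negb_and !negbK => /orP[/eqP XA|/eqP AX].
  by rewrite (eq_cut_in (Y := set0) EA) ?cut_set0 // XA set0I.
rewrite -cutC (eq_cut_in (Y := set0) EA) ?cut_set0 // set0I.
by rewrite setIC -setDE.
Qed.

Lemma crosses_set1 z e : crosses [set z] e -> e.1 != z ->
  exists2 v, v != z & e = (v, z).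
Proof.
case: e => a b; rewrite /crosses !inE /= => ab az.
by exists a => //; move: ab; rewrite (negbTE az) => /= /eqP ->.
Qed.

(* Cuts do not see the direction of an edge, so we may let all edges at [z]
   end there. *)
Lemma edges_towards z A E : edges_in A E ->
  exists E', [/\ edges_in A E', cut E' =1 cut E & {in E', forall e, e.1 != z}].
Proof.
move=> /allP EA; pose g e := if e.1 == z then flip e else e.
exists (map g E); split=> [|X|_ /mapP[e /EA /and3P[_ _ e12] ->]].
- rewrite /edges_in all_map; apply/allP=> e /EA /= /and3P[e1 e2 e12].
  by rewrite /g; case: ifP => _ /=; rewrite ?e1 ?e2 // eq_sym.
- rewrite /cut count_map; apply: eq_count => e.
  by rewrite /= /g; case: ifP => // _; rewrite crosses_flip.
- by rewrite /g; case: (eqVneq e.1 z) e12 => [->|//]; rewrite eq_sym.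
Qed.

(** * Edge-connectivity and tight sets *)

Definition connected_on K A E : bool :=
  [forall X, separates X A ==> (K <= cut E X)].

Lemma connected_onP K A E :
  reflect (forall X, separates X A -> K <= cut E X) (connected_on K A E).
Proof.
by apply: (iffP forallP) => geK X; [apply/implyP | apply/implyP/geK].
Qed.

Lemma perm_connected_on K A E F :
  perm_eq E F -> connected_on K A E = connected_on K A F.
Proof. by move=> EF; apply: eq_forallb => X; rewrite (perm_cut X EF). Qed.

Lemma connected_on_subset K A B E :
  A \subset B -> connected_on K B E -> connected_on K A E.
Proof.
move=> AB /connected_onP conE; apply/connected_onP => X sX.
exact: conE (separatesS AB sX).
Qed.

Definition tight K A E X : bool :=
  separates X A && (cut E X == K).

Definition tight_edge K A E e : bool :=
  [exists X, tight K A E X && crosses X e].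

Lemma connected_on_cons K A E e : connected_on K A (e :: E) ->
  connected_on K A E || tight_edge K A (e :: E) e.
Proof.
move=> /connected_onP conE; have [//|] := boolP (connected_on K A E).
rewrite negb_forall => /existsP[X]; rewrite negb_imply -ltnNge => /andP[sX ltX].
apply/existsP; exists X; have := conE X sX; rewrite /tight sX cut_cons.
by case: crosses => /=; rewrite ?andbT; lia.
Qed.

Lemma perm_tight_edge K A E F :
  perm_eq E F -> tight_edge K A E =1 tight_edge K A F.
Proof.
by move=> EF e; apply: eq_existsb => X; rewrite /tight (perm_cut X EF).
Qed.

Lemma tightD K A E X Y : connected_on K A E -> tight K A E X ->
    tight K A E Y -> (X :\: Y) :&: A != set0 -> (Y :\: X) :&: A != set0 ->
  tight K A E (X :\: Y).
Proof.
move=> /connected_onP conE /andP[sX /eqP cX] /andP[sY /eqP cY] XY YX.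
have separatesD (P Q : {set T}) :
    separates P A -> (P :\: Q) :&: A != set0 -> separates (P :\: Q) A.
  move=> /andP[_ AP] PQ; rewrite /separates PQ; apply: contraNneq AP => AD.
  by rewrite -subset0 -AD setDS ?subsetDl.
have sXY := separatesD X Y sX XY; rewrite /tight sXY eqn_leq conE // andbT.
by have := conE _ (separatesD Y X sY YX); have := cut_posimod E X Y; lia.
Qed.

(* By uncrossing: a tight set crossed by an edge inside [X :&: S] would give
   a tight set meeting [S] in fewer vertices. *)
Lemma exists_tight_independent K A E S : connected_on K A E -> S \subset A ->
    (exists X, tight K A E X && (X :&: S != set0)) ->
  exists X, [/\ tight K A E X, X :&: S != set0 &
    forall e, tight_edge K A E e ->
      ~~ ((e.1 \in X :&: S) && (e.2 \in X :&: S))].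
Proof.
move=> conE SA [X0 meetX0].
pose tight_meeting X := tight K A E X && (X :&: S != set0).
case: (@arg_minnP _ X0 tight_meeting (fun X => #|X :&: S|) meetX0).
move=> X /andP[tX XS] minX; exists X; split=> // e /existsP[Y /andP[tY eY]].
apply/negP => /andP[/setIP[e1X e1S] /setIP[e2X e2S]].
have smaller Z :
    tight K A E Z -> crosses Z e -> Z :&: S \subset X :&: S -> False.
  move=> tZ eZ ZX; have meetZ := crosses_meets e1S e2S eZ.
  have /minX : tight_meeting Z by rewrite /tight_meeting tZ.
  rewrite leqNgt => /negP; apply; apply/proper_card/properP; split=> //.
  move: eZ; rewrite /crosses; have [_ /= e2Z|e1Z _] := boolP (e.1 \in Z).
    by exists e.2; rewrite inE ?e2X ?(negbTE e2Z).
  by exists e.1; rewrite inE ?e1X ?(negbTE e1Z).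
have [YX|meetYX] := eqVneq ((Y :\: X) :&: S) set0.
  apply: (smaller Y tY eY); apply/subsetP => x /setIP[xY xS].
  by have := in_set0 x; rewrite -YX !inE xY xS !andbT => /negbFE ->.
have eXY : crosses (X :\: Y) e.
  by rewrite /crosses !inE e1X e2X !andbT addNb addbN negbK.
have meetA (Z : {set T}) : Z :&: S != set0 -> Z :&: A != set0.
  by apply: contraNneq => ZA; rewrite -subset0 -ZA setIS.
apply: (smaller (X :\: Y)) => //; last by rewrite setSI ?subsetDl.
apply: tightD tX tY _ (meetA _ meetYX) => //.
by rewrite meetA // (crosses_meets e1S).
Qed.

End Cuts.

(** * Splitting off a vertex *)

Lemma count_lt_exists (I : eqType) (a b : pred I) (s : seq I) :
  count a s < count b s -> exists2 x, x \in s & b x && ~~ a x.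
Proof.
move=> lt_ab; apply/hasP; apply: contraLR lt_ab => /hasPn none.
rewrite -leqNgt (@eq_in_count _ _ (predI a b)) => [|x /none /=].
  by apply: sub_count => x /andP[].
by rewrite negb_and negbK; case: (a x); case: (b x).
Qed.

Section SplittingOff.
Variables (T : finType) (K : nat) (A : {set T}) (z : T).
Implicit Types (X Y : {set T}) (E F M : seq (T * T)) (e f : T * T) (u v : T).
Hypothesis K_even : ~~ odd K.

(* Sets preventing the split of an edge [uz] with an edge [vz], [v] in [X]. *)
Definition dangerous E u X : bool :=
  [&& X \proper A :\ z, u \in X & cut E X <= K.+1].

Lemma dangerous_notin E u X : dangerous E u X -> z \notin X.
Proof.
case/and3P=> /proper_sub/subsetP XA _ _.
by apply/negP => /XA; rewrite !inE eqxx.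
Qed.

Section Dangerous.
Variables (E : seq (T * T)) (u : T).
Hypotheses (EA : edges_in A E) (conE : connected_on K (A :\ z) E).
Hypotheses (z_even : ~~ odd (cut E [set z])) (uE : (u, z) \in E).
Hypothesis towards_z : {in E, forall e, e.1 != z}.

(* The edge [uz] makes posimodularity tight, whence [cut E (X :\: Y)] is [K]
   and [cut E X] is [K.+1]; parity then forces [cut E (X :&: Y)] above [K] and
   forbids [X :|: Y] to be all of [A :\ z]. *)
Lemma dangerousU X Y :
  dangerous E u X -> dangerous E u Y -> dangerous E u (X :|: Y).
Proof.
move=> dX dY.
have [XY|nXY] := boolP (X \subset Y); first by rewrite (setUidPr XY).
have [YX|nYX] := boolP (Y \subset X); first by rewrite (setUidPl YX).
have zX := dangerous_notin dX; have zY := dangerous_notin dY.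
case/and3P: dX => pX uX leX; case/and3P: dY => pY uY leY.
have cut_ge (P Q : {set T}) :
    P \proper A :\ z -> Q \subset P -> Q != set0 -> K <= cut E Q.
  move=> pP QP Q0; apply: (connected_onP _ _ _ conE).
  exact: separates_proper Q0 (sub_proper_trans QP pP).
have geXY : K <= cut E (X :\: Y).
  by apply: cut_ge pX (subsetDl _ _) _; rewrite setD_eq0.
have geYX : K <= cut E (Y :\: X).
  by apply: cut_ge pY (subsetDl _ _) _; rewrite setD_eq0.
have geI : K <= cut E (X :&: Y).
  by apply: cut_ge pX (subsetIl _ _) _; apply/set0Pn; exists u; rewrite inE uX.
have : cut E (X :\: Y) + cut E (Y :\: X) + 2 <= cut E X + cut E Y.
  by apply: cut_posimod_edge uE _ _; rewrite !inE ?uX // negb_or zX.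
move=> posimod; have [cX cYX cXY] :
    [/\ cut E X = K.+1, cut E (Y :\: X) = K & cut E (X :\: Y) = K].
  by clear - geXY geYX leX leY posimod; split; lia.
have oddI : odd (cut E (X :&: Y)).
  have := @odd_cutU _ E (X :&: Y) (X :\: Y).
  rewrite setID cX cXY /= (negbTE K_even) addbF => <- //.
  rewrite -setI_eq0; apply/eqP/setP => x; rewrite !inE.
  by case: (x \in Y); rewrite ?andbF.
have gtI : K < cut E (X :&: Y).
  by rewrite ltn_neqAle geI andbT; apply: contraNneq K_even => ->.
rewrite /dangerous properEneq !inE uX subUset !proper_sub //= andbT.
apply/andP; split; last first.
  by have := cut_submod E X Y; clear - gtI leX leY; lia.
apply: contra K_even => /eqP XYA.
have <- : cut E (z |: X) = K.
  rewrite -cYX -cutC; apply: (eq_cut_in EA); apply/setP => x.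
  move/setP: XYA => /(_ x); rewrite !inE.
  by case: (x =P z) => [-> _|_]; rewrite ?(negbTE zY) ?andbF //= => <-;
    case: (x \in X) => //=; case: (x \in Y).
rewrite odd_cutU ?cX ?disjoints1 //=.
by rewrite (negbTE z_even) (negbTE K_even).
Qed.

Lemma exists_admissible_edge :
  exists2 v, (v, z) \in rem (u, z) E & forall X, dangerous E u X -> v \notin X.
Proof.
have uz : u != z := towards_z uE; have remE := perm_to_rem uE.
case: (pickP (dangerous E u)) => [X0 dX0|no_dangerous]; last first.
  have /hasP[f fE fz] : has (crosses [set z]) (rem (u, z) E).
    move: z_even; rewrite has_count -/(cut _ _) (perm_cut _ remE) cut_cons.
    by rewrite /crosses !inE eqxx (negbTE uz) /=; case: (cut _ _).
  have [v vz eq_f] := crosses_set1 fz (towards_z (mem_rem fE)).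
  exists v => [|X]; first by rewrite -eq_f.
  by rewrite no_dangerous.
have [X dX maxX] : exists2 X, dangerous E u X &
    forall Y, dangerous E u Y -> #|Y| <= #|X|.
  case: (@arg_maxnP _ X0 (dangerous E u) (fun X => #|X|) dX0) => X dX maxX.
  by exists X.
have zX := dangerous_notin dX; have /and3P[pX uX leX] := dX.
have sepX : separates (z |: X) (A :\ z).
  have /properP[/subsetP/(_ u uX) uA [a aA aX]] := pX.
  apply/separatesP; split; first by exists u; rewrite // !inE uX orbT.
  exists a => //; move: aA.
  by rewrite !inE (negbTE aX) orbF => /andP[].
have [f fE /andP[fz fX]] : exists2 f, f \in E &
    crosses [set z] f && ~~ joins [set z] X f.
  have cut_zX : cut E (z |: X) + 2 * count (joins [set z] X) E =
      cut E [set z] + cut E X by apply: cutU; rewrite disjoints1.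
  have cut_z : 1 < cut E [set z].
    move: z_even; rewrite (perm_cut _ remE) cut_cons /crosses !inE eqxx.
    by rewrite (negbTE uz); case: (cut _ _) => [|[]].
  have : count (joins [set z] X) E < cut E [set z].
    have := connected_onP _ _ _ conE _ sepX; clear - cut_zX cut_z leX; lia.
  exact: count_lt_exists.
have [v vz eq_f] := crosses_set1 fz (towards_z fE); rewrite {}eq_f in fE fX.
have {}fX : v \notin X.
  by move: fX; rewrite /joins !inE /= eqxx (negbTE zX) andbF andbT.
exists v => [|Y dY].
  move: fE; rewrite (perm_mem remE) inE => /predU1P[[vu]|//].
  by rewrite vu uX in fX.
apply: contra fX => vY.
have /eqP -> : X == X :|: Y; last by rewrite inE vY orbT.
by rewrite eqEcard subsetUl maxX // dangerousU.
Qed.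

End Dangerous.

Definition split_edge u v E : seq (T * T) :=
  if u == v then E else (u, v) :: E.

Lemma cut_split_edge u v E X :
  cut (split_edge u v E) X = ((u \in X) (+) (v \in X)) + cut E X.
Proof.
by rewrite /split_edge; case: eqP => [->|_]; rewrite ?addbb ?cut_cons.
Qed.

Lemma cut_split_away u v E F X : z \notin X ->
    perm_eq E [:: (u, z), (v, z) & F] ->
  cut E X = cut (split_edge u v F) X + 2 * ((u \in X) && (v \in X)).
Proof.
move=> /negbTE zX EF; rewrite (perm_cut _ EF) !cut_cons cut_split_edge.
by rewrite /crosses /= zX; case: (u \in X); case: (v \in X); rewrite /=; lia.
Qed.

Lemma connected_on_split_edge u v E F :
    edges_in A E -> connected_on K (A :\ z) E ->
    perm_eq E [:: (u, z), (v, z) & F] -> u \in A :\ z -> v \in A :\ z ->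
    (forall X, dangerous E u X -> v \notin X) ->
  connected_on K (A :\ z) (split_edge u v F).
Proof.
move=> EA /connected_onP conE EF uA vA safe; apply/connected_onP.
suff away X : z \notin X -> separates X (A :\ z) ->
    K <= cut (split_edge u v F) X.
  move=> X sX; have [zX|/away] := boolP (z \in X); last exact.
  by rewrite -cutC; apply: away; rewrite ?separatesC // inE zX.
move=> zX sX; have := conE _ sX; rewrite (cut_split_away zX EF).
have [/andP[uX vX]|_] := boolP (_ && _); last by rewrite muln0 addn0.
rewrite leqNgt => geK; apply/negP => ltK.
have := safe (X :&: (A :\ z)); rewrite inE vX vA => /(_ _)/wrap[] //.
apply/and3P; split; last 1 first.
- rewrite (eq_cut_in (Y := X) EA) ?(cut_split_away zX EF) ?uX ?vX.
    by clear - ltK; lia.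
  apply/setP => x; rewrite !inE; case: (x =P z) => [->|_].
    by rewrite (negbTE zX).
  by rewrite /= -andbA andbb.
- rewrite properEneq subsetIr andbT; case/andP: sX => _.
  by apply: contraNneq => XA; rewrite -XA setDIl setDv set0I.
- by rewrite inE uX uA.
Qed.

Lemma split_once E : edges_in A E -> connected_on K (A :\ z) E ->
    ~~ odd (cut E [set z]) -> 0 < cut E [set z] ->
  exists E', [/\ edges_in A E', connected_on K (A :\ z) E',
    cut E [set z] = cut E' [set z] + 2 &
    forall X, z \notin X -> cut E' X <= cut E X /\
                            odd (cut E' X) = odd (cut E X)].
Proof.
move: E => E0 EA0 conE0; have [E [EA eqE towards_z]] := edges_towards z EA0.
have conE : connected_on K (A :\ z) E.
  by apply/connected_onP => X; rewrite eqE; apply: connected_onP.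
rewrite -eqE => z_even z_pos.
have /hasP[e eE ez] : has (crosses [set z]) E by rewrite has_count.
have [u uz eq_e] := crosses_set1 ez (towards_z e eE); rewrite {}eq_e in eE.
have [v vE safe] := exists_admissible_edge EA conE z_even eE towards_z.
pose F := rem (v, z) (rem (u, z) E).
have EF : perm_eq E [:: (u, z), (v, z) & F].
  by apply: perm_trans (perm_to_rem eE) _; rewrite perm_cons perm_to_rem.
have vz : v != z by exact: towards_z (mem_rem vE).
have /and3P[/and3P[uA _ _] /and3P[vA _ _] FA] :
    edges_in A [:: (u, z), (v, z) & F].
  by rewrite /edges_in -(perm_all _ EF).
exists (split_edge u v F); split.
- by rewrite /split_edge; case: eqVneq => //= uv; rewrite uA vA uv.
- by apply: connected_on_split_edge EF _ _ safe; rewrite // !inE ?uz ?vz.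
- rewrite (perm_cut _ EF) !cut_cons cut_split_edge /crosses !inE eqxx.
  by rewrite (negbTE uz) (negbTE vz) /= !add1n addn2.
- move=> X zX; rewrite -eqE (cut_split_away zX EF) leq_addr oddD.
  by rewrite mul2n odd_double addbF.
Qed.

Lemma split_off E : edges_in A E -> connected_on K (A :\ z) E ->
    ~~ odd (cut E [set z]) ->
  exists E', [/\ edges_in (A :\ z) E', connected_on K (A :\ z) E' &
    forall X, z \notin X -> cut E' X <= cut E X /\
                            odd (cut E' X) = odd (cut E X)].
Proof.
have [d] := ubnP (cut E [set z]); elim: d E => // d IH E led EA conE z_even.
have [z0|z_pos] := posnP (cut E [set z]).
  exists E; split => //; apply/allP => e eE.
  have /and3P[e1 e2 e12] := allP EA _ eE.
  rewrite !inE e1 e2 e12 !andbT -negb_or; apply: contra_eqN z0 => e_z.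
  rewrite -lt0n -has_count; apply/hasP; exists e => //.
  rewrite /crosses !inE; case/orP: e_z => /eqP ez; rewrite ez eqxx in e12 *.
    by rewrite eq_sym.
  by rewrite addbT.
have [E1 [E1A conE1 cut1 leE1]] := split_once EA conE z_even z_pos.
case: (IH E1) => // [||E' [E'A conE' leE']].
- by move: led; rewrite cut1 addn2 ltnS => /ltnW.
- by move: z_even; rewrite cut1 oddD addbF.
exists E'; split => // X zX.
have [le1 odd1] := leE1 X zX; have [le' odd'] := leE' X zX.
by split; [exact: leq_trans le' le1 | rewrite odd'].
Qed.

End SplittingOff.

(** * Parity corrections *)

Section ParityCorrections.
Variable T : finType.
Implicit Types (A X Y : {set T}) (E M : seq (T * T)) (K : nat).

Lemma exists_degree_eq K A E : 0 < K -> edges_in A E -> connected_on K A E ->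
    1 < #|A| -> {in E, forall e, tight_edge K A E e} ->
  exists2 z, z \in A & cut E [set z] = K.
Proof.
move=> K_gt0 EA conE A_gt1 tightE.
have degree_ge z : z \in A -> K <= cut E [set z].
  move=> zA; apply/(connected_onP _ _ _ conE)/separates_proper.
    by apply/set0Pn; exists z; rewrite inE.
  by rewrite properEcard sub1set zA cards1.
have meetsA : exists X, tight K A E X && (X :&: A != set0).
  have [a aA] : exists a, a \in A by apply/card_gt0P; exact: ltnW.
  have /hasP[e eE _] : has (crosses [set a]) E.
    by rewrite has_count; exact: leq_trans K_gt0 (degree_ge a aA).
  have /existsP[X /andP[tX eX]] := tightE e eE; exists X; rewrite tX.
  by have /and3P[e1 e2 _] := allP EA e eE; exact: crosses_meets eX.
have [X [/andP[_ /eqP cX] X_A indX]] :=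
  exists_tight_independent conE (subxx A) meetsA.
have /set0Pn[z zXA] := X_A; have /setIP[_ zA] := zXA; exists z => //.
have disj : [disjoint [set z] & (X :&: A) :\ z] by rewrite disjoints1 !inE eqxx.
have := cutU E disj; rewrite setD1K //.
rewrite (eq_cut_in (Y := X) EA) -?setIA ?setIid // cX.
have -> : count (joins [set z] ((X :&: A) :\ z)) E = 0.
  apply/eqP; rewrite -leqn0 leqNgt -has_count; apply/hasPn => e eE.
  apply: contra (indX e (tightE e eE)); rewrite /joins !in_setD1 !in_set1.
  case/orP => /andP[]; first by move=> /eqP -> /andP[_ ->]; rewrite zXA.
  by move=> /andP[_ ->] /eqP ->; rewrite zXA.
by have := degree_ge z zA; lia.
Qed.

Definition parity_corrects K A E M : Prop :=
  [/\ edges_in A M, forall X, ~~ odd (cut E X + cut M X) &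
    forall X, separates X A -> cut M X + K <= cut E X].

Lemma parity_corrects_cons K A E e M :
  [&& e.1 \in A, e.2 \in A & e.1 != e.2] ->
  parity_corrects K A E M -> parity_corrects K A (e :: E) (e :: M).
Proof.
move=> eA [MA oddM leM]; split=> [|X|X sX].
- by rewrite /edges_in /= eA.
- by rewrite !cut_cons addnACA addnn oddD odd_double; exact: oddM.
- by rewrite !cut_cons -addnA leq_add2l; exact: leM.
Qed.

Lemma perm_parity_corrects K A E F M : perm_eq E F ->
  parity_corrects K A E M -> parity_corrects K A F M.
Proof.
move=> EF [MA oddM leM].
by split=> // X; rewrite -(perm_cut _ EF); [exact: oddM | exact: leM].
Qed.

Lemma parity_corrects_split_off K A z E E' M :
    connected_on K A E ->
    (forall X, z \notin X ->
       cut E' X <= cut E X /\ odd (cut E' X) = odd (cut E X)) ->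
  parity_corrects K (A :\ z) E' M -> parity_corrects K A E M.
Proof.
move=> conE leE' [MA oddM leM]; split=> [|X|X sX].
- by apply: sub_all MA => e; rewrite !inE => /and3P[/andP[_ ->] /andP[_ ->] ->].
- wlog zX : X / z \notin X.
    move=> away; have [zX|/away //] := boolP (z \in X).
    by rewrite -[cut E X]cutC -[cut M X]cutC; apply: away; rewrite inE zX.
  by have := oddM X; have [_ oddE'] := leE' X zX; rewrite !oddD oddE'.
- wlog zX : X sX / z \notin X.
    move=> away; have [zX|zX] := boolP (z \in X); last exact: away.
    rewrite -[cut E X]cutC -[cut M X]cutC.
    by apply: away; rewrite ?separatesC // inE zX.
  have [sX'|nsX'] := boolP (separates X (A :\ z)).
    exact: leq_trans (leM _ sX') (leE' _ zX).1.
  by rewrite (cut_not_separated MA nsX'); exact: connected_onP conE _ sX.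
Qed.

(* Delete edges while the connectivity survives; then some vertex has degree
   exactly [K], and splitting it off reduces the number of vertices. *)
Lemma exists_parity_correction K A E :
    ~~ odd K -> 0 < K -> edges_in A E -> connected_on K A E ->
  exists M, parity_corrects K A E M.
Proof.
move=> K_even K_gt0; have [c] := ubnP #|A|; elim: c A E => // c IHA A E leA.
have [d] := ubnP (size E); elim: d E => // d IHE E leE EA conE.
have [A_le1|A_gt1] := leqP #|A| 1.
  exists E; split=> [//|X|X /separates_card]; last by rewrite ltnNge A_le1.
  by rewrite addnn odd_double.
have [/hasP[e eE con_rem]|/hasPn min_conE] :=
    boolP (has (fun e => connected_on K A (rem e E)) E).
  have remE := perm_to_rem eE.
  have EA' : edges_in A (e :: rem e E) by rewrite /edges_in -(perm_all _ remE).
  case/andP: EA' => eA remA.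
  have [|M parM] := IHE (rem e E) _ remA con_rem.
    by rewrite size_rem //; case: (E) eE leE.
  exists (e :: M); apply: (perm_parity_corrects (E := e :: rem e E)).
    by rewrite perm_sym.
  exact: parity_corrects_cons eA parM.
have [z zA cz] : exists2 z, z \in A & cut E [set z] = K.
  apply: exists_degree_eq => // e eE; have remE := perm_to_rem eE.
  rewrite (perm_tight_edge _ _ remE); move: conE.
  rewrite (perm_connected_on _ _ remE) => /connected_on_cons.
  by rewrite (negbTE (min_conE e eE)).
have [||E' [E'A conE' leE']] := split_off (z := z) K_even EA.
- exact: connected_on_subset (subsetDl _ _) conE.
- by rewrite cz.
have [|M parM] := IHA (A :\ z) E' _ E'A conE'.
  by move: leA; rewrite (cardsD1 z A) zA.
by exists M; exact: parity_corrects_split_off conE leE' parM.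
Qed.

End ParityCorrections.

(** * Orientations *)

Section Orientations.
Variable T : finType.
Implicit Types (X : {set T}) (E F G M : seq (T * T)) (e f : T * T) (u v w : T).

Definition ends e : {set T} := [set e.1; e.2].

Definition orients E F : Prop := map ends E = map ends F.

Lemma ends_eqP e f : reflect (f = e \/ f = flip e) (ends e == ends f).
Proof.
apply: (iffP eqP) => [|[->|->] //]; last by rewrite /ends setUC.
case: e f => [a b] [c d]; rewrite /ends /flip /= => eq_ends.
have /set2P a_cd : a \in [set c; d] by rewrite -eq_ends set21.
have /set2P b_cd : b \in [set c; d] by rewrite -eq_ends set22.
have /set2P c_ab : c \in [set a; b] by rewrite eq_ends set21.
have /set2P d_ab : d \in [set a; b] by rewrite eq_ends set22.
by case: a_cd b_cd c_ab d_ab => ? [] ? [] ? [] ?; subst; auto.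
Qed.

Lemma orients_cut E F X : orients E F -> cut E X = cut F X.
Proof.
elim: E F => [|e E IH] [|f F] // [ends_ef EF]; rewrite !cut_cons (IH F EF).
by have /eqP/ends_eqP[->|->] := ends_ef; rewrite ?crosses_flip.
Qed.

Lemma orients_cat E1 E2 F : orients (E1 ++ E2) F ->
  exists F1 F2, [/\ F = F1 ++ F2, orients E1 F1 & orients E2 F2].
Proof.
rewrite /orients map_cat => EF; exists (take (size E1) F), (drop (size E1) F).
by split; rewrite ?cat_take_drop // ?map_take ?map_drop -EF ?take_size_cat
  ?drop_size_cat ?size_map.
Qed.

Lemma cat_orients E1 E2 F1 F2 :
  orients E1 F1 -> orients E2 F2 -> orients (E1 ++ E2) (F1 ++ F2).
Proof. by rewrite /orients !map_cat => -> ->. Qed.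

Lemma mem_orients E F f : orients E F -> f \in F -> (f \in E) || (flip f \in E).
Proof.
move=> EF /(map_f ends); rewrite -EF => /mapP[e eE /eqP/ends_eqP[] <-].
  by rewrite eE.
by rewrite eE orbT.
Qed.

Lemma orients_uniq E F : orients E F -> uniq (map ends E) -> uniq F.
Proof. by move=> ->; exact: map_uniq. Qed.

Lemma orients_asym E F f : orients E F -> uniq (map ends E) ->
  f \in F -> flip f \in F -> flip f = f.
Proof.
move=> -> uF fF flipF; apply/eqP; apply: contraTT uF => neq.
rewrite (perm_uniq (perm_map ends (perm_to_rem fF))) /= negb_and negbK.
apply/orP; left; apply/mapP; exists (flip f); last by rewrite /ends setUC.
by move: flipF; rewrite (perm_mem (perm_to_rem fF)) inE (negbTE neq).
Qed.

Definition balanced F : Prop :=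
  forall X, count (leaves X) F = count (leaves (~: X)) F.

Lemma balanced_subdivide u v w f E1 E2 : ends f = ends (v, w) ->
    (exists2 G, orients ((u, w) :: E1 ++ E2) G & balanced G) ->
  exists2 F, orients ((u, v) :: E1 ++ f :: E2) F & balanced F.
Proof.
move=> ends_f [[//|g G] [/eqP/ends_eqP g_uw oG] balG].
have [F1 [F2 [eqG oF1 oF2]]] := orients_cat oG; rewrite {}eqG in balG.
have oriented (a b : T * T) : ends (u, v) = ends a -> ends (v, w) = ends b ->
    orients ((u, v) :: E1 ++ f :: E2) (a :: F1 ++ b :: F2).
  move=> ends_a ends_b; rewrite /orients /= ends_a; congr (_ :: _).
  by apply: cat_orients oF1 _; rewrite /orients /= ends_f ends_b oF2.
case: g_uw balG => -> balG; [exists ((u, v) :: F1 ++ (v, w) :: F2)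
  | exists ((v, u) :: F1 ++ (w, v) :: F2)];
  try by apply: oriented; rewrite /ends setUC.
all: move=> X; have := balG X; rewrite /= !count_cat /= !(addnCA (count _ F1)).
all: move: (count _ F1 + _) (count _ F1 + _) => leaving entering.
all: rewrite /leaves !inE /= !negbK; clear.
all: by case: (u \in X); case: (v \in X); case: (w \in X) => /=; lia.
Qed.

Lemma eulerian_orientation E : (forall X, ~~ odd (cut E X)) ->
  exists2 F, orients E F & balanced F.
Proof.
have [d] := ubnP (size E); elim: d E => // d IH [|[u v] E] leE evenE.
  by exists [::].
have [uv|uv] := eqVneq u v.
  subst v; case: (IH E) => [//|X|F oF balF].
    by have := evenE X; rewrite cut_cons /crosses addbb.
  exists ((u, u) :: F); first by rewrite /orients /= oF.
  by move=> X; rewrite /= balF /leaves !inE negbK andbN andNb.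
have /hasP[f fE vf] : has (crosses [set v]) E.
  have := evenE [set v]; rewrite cut_cons /crosses !inE (negbTE uv) eqxx /=.
  by rewrite has_count -/(cut E [set v]); case: (cut _ _).
have [w ends_f] : exists w, ends f = ends (v, w).
  move: vf; rewrite /crosses !inE /ends /=.
  case: eqP => [->|_]; first by exists f.2.
  by move=> /eqP ->; exists f.1; rewrite setUC.
case/splitPr: fE leE evenE => E1 E2 leE evenE.
have cut_f X : crosses X f = crosses X (v, w).
  by have /eqP/ends_eqP[->|->] := ends_f; rewrite ?crosses_flip.
apply: balanced_subdivide ends_f _; apply: IH => [|X].
  by move: leE; rewrite /= !size_cat /= addnS.
have := evenE X; rewrite !cut_cons !cut_cat cut_cons cut_f /crosses.
rewrite !oddD /= !oddb; move: (odd _) (odd _).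
by case: (u \in X); case: (v \in X); case: (w \in X) => // -[] [].
Qed.

(* Make all degrees even by a parity correction and orient the result along
   closed trails; discarding the correction costs each cut at most the slack. *)
Lemma exists_strong_orientation K E G : ~~ odd K -> 0 < K ->
    edges_in setT (E ++ G) -> connected_on K setT (E ++ G) ->
    (forall X, ~~ odd (cut G X)) ->
  exists2 F, orients E F &
    forall X, separates X setT -> K <= 2 * count (leaves X) F + cut G X.
Proof.
move=> K_even K_gt0 EG conEG evenG.
have [M [_ oddM leM]] := exists_parity_correction K_even K_gt0 EG conEG.
have [|FM /orients_cat[F [M' [eqFM oF oM]]] balFM] :=
    @eulerian_orientation (E ++ M).
  by move=> X; have := oddM X; rewrite !cut_cat !oddD (negbTE (evenG X)) addbF.
exists F => // X sX; have := leM X sX; have := balFM X.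
rewrite eqFM !count_cat cut_cat (orients_cut X oF) (orients_cut X oM).
by rewrite !cut_leaves; clear; lia.
Qed.

End Orientations.

(** * Prescribed dot products *)

Section DotProducts.
Import GRing.Theory.
Local Open Scope ring_scope.

Definition dot (R : comNzRingType) s (x y : 'rV[R]_s) : R := (x *m y^T) 0 0.

Lemma dotE (R : comNzRingType) s (x y : 'rV[R]_s) :
  dot x y = \sum_i x 0 i * y 0 i.
Proof. by rewrite /dot mxE; apply: eq_bigr => i _; rewrite mxE. Qed.

Lemma dotC (R : comNzRingType) s (x y : 'rV[R]_s) : dot x y = dot y x.
Proof. by rewrite !dotE; apply: eq_bigr => i _; rewrite mulrC. Qed.

Lemma dot_row_mx (R : comNzRingType) s t (x1 y1 : 'rV[R]_s) (x2 y2 : 'rV[R]_t) :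
  dot (row_mx x1 x2) (row_mx y1 y2) = dot x1 y1 + dot x2 y2.
Proof. by rewrite /dot tr_row_mx mul_row_col mxE. Qed.

Lemma exists_offdiagonal_gram (R : comNzRingType) n
    (a : 'I_n.+1 -> 'I_n.+1 -> R) :
    (forall i j, a i j = a j i) ->
  exists z : 'I_n.+1 -> 'rV[R]_n, forall i j, i != j -> dot (z i) (z j) = a i j.
Proof.
elim: n a => [|n IH] a a_sym.
  by exists (fun=> 0) => i j; rewrite !ord1 eqxx.
pose tail := lift (ord0 : 'I_n.+2).
pose a' i j := a (tail i) (tail j) - a ord0 (tail i) * a ord0 (tail j).
have [|z gram_z] := IH a'.
  by move=> i j; rewrite /a' a_sym mulrC.
pose zS (i : 'I_n.+2) : 'rV[R]_(1 + n) :=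
  if unlift ord0 i is Some i' then row_mx (a ord0 i)%:M (z i')
  else row_mx 1%:M 0.
have dot_scalar (x y : R) : dot (x%:M : 'rV_1) y%:M = x * y.
  by rewrite /dot tr_scalar_mx -scalar_mxM mxE eqxx.
have dot0 s (x : 'rV[R]_s) : dot 0 x = 0 by rewrite /dot mul0mx mxE.
suff gram_zS i j : i != j -> dot (zS i) (zS j) = a i j by exists zS.
rewrite /zS.
case: unliftP => [i'|] ->; case: unliftP => [j'|] -> ij;
  rewrite dot_row_mx dot_scalar.
- rewrite (inj_eq lift_inj) in ij; rewrite (gram_z _ _ ij) addrC.
  by rewrite subrK.
- by rewrite dotC dot0 mulr1 addr0 a_sym.
- by rewrite dot0 mul1r addr0.
- by rewrite eqxx in ij.
Qed.

Variables (F : finFieldType) (T : finType) (s : nat).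
Implicit Types (z : T -> 'rV[F]_s) (I J : {set T}) (a : T -> F).

Definition spanned z I : {set 'rV[F]_s} := [set y in <<[seq z u | u in I]>>%VS].

Definition free_on z I : bool := free [seq z u | u in I].

Lemma spanned0 z I : 0 \in spanned z I.
Proof. by rewrite inE mem0v. Qed.

Lemma card_spanned z I : (#|spanned z I| <= #|F| ^ #|I|)%N.
Proof.
rewrite cardsE (@card_vspace F 'rV[F]_s); apply: leq_pexp2l.
  by apply/card_gt0P; exists 0.
by apply: leq_trans (dim_span _) _; rewrite size_image.
Qed.

Lemma spannedS z I J : I \subset J -> spanned z I \subset spanned z J.
Proof.
move=> IJ; apply/subsetP => y; rewrite !inE; apply/subvP/sub_span => x.
by case/imageP => u uI ->; apply/image_f/(subsetP IJ).
Qed.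

Lemma free_on_setU1 z J v : v \notin J ->
  free_on z (v |: J) = (z v \notin spanned z J) && free_on z J.
Proof.
move=> vJ; rewrite inE -free_cons; apply/perm_free.
rewrite -[z v :: _]/(map z (v :: enum J)); apply/perm_map/uniq_perm.
- exact: enum_uniq.
- by rewrite /= mem_enum vJ enum_uniq.
- by move=> u; rewrite mem_enum !inE mem_enum.
Qed.

Lemma eq_free_on z z' I : {in I, z =1 z'} -> free_on z I = free_on z' I.
Proof.
move=> zz'; congr (free _).
by apply/eq_in_map => u; rewrite mem_enum; exact: zz'.
Qed.

Lemma eq_spanned z z' I : {in I, z =1 z'} -> spanned z I = spanned z' I.
Proof.
move=> zz'; suff eq_seq : [seq z u | u in I] = [seq z' u | u in I].
  by rewrite /spanned eq_seq.
by apply/eq_in_map => u; rewrite mem_enum; exact: zz'.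
Qed.

(* The matrix [A] with rows [z u] has a right inverse [B], so every [y] is
   recovered from [A y] and its translate [y + B (a - A y)], a solution. *)
Lemma card_dot_solutions z I a : free_on z I ->
  (#|F| ^ s <=
   #|[set y | [forall u in I, dot y (z u) == a u]]| * #|F| ^ #|I|)%N.
Proof.
move=> freeI; pose A := \matrix_(i < #|I|) z (enum_val i).
have /row_freeP[B AB] : row_free A.
  apply: inj_row_free => c cA; apply/rowP => i; rewrite mxE.
  apply: (freeP (X := image_tuple z (mem I)) freeI (c 0) _ i).
  rewrite -[RHS]cA mulmx_sum_row; apply: eq_bigr => j _.
  by rewrite rowK nth_image.
pose b : 'cV_#|I| := \col_i a (enum_val i); set sol := [set y | _].
pose shift (y : 'rV_s) := y + (B *m (b - A *m y^T))^T.
have shift_sol y : shift y \in sol.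
  rewrite inE; apply/forall_inP => u uI; apply/eqP.
  have A_shift : A *m (shift y)^T = b.
    by rewrite linearD /= trmxK mulmxDr mulmxA AB mul1mx addrC subrK.
  pose r := enum_rank_in uI u.
  have r_u : enum_val r = u by rewrite enum_rankK_in.
  have <- : row r A = z u by rewrite rowK r_u.
  by rewrite dotC /dot -row_mul A_shift !mxE r_u.
pose decompose y := (shift y, A *m y^T).
have decompose_inj : injective decompose.
  by move=> y y' [+ eqA]; rewrite /shift eqA => /addIr.
have := card_imset setT decompose_inj; rewrite cardsT card_mx mul1n => <-.
have -> : (#|F| ^ #|I| = #|[set: 'cV[F]_#|I|]|)%N.
  by rewrite cardsT card_mx muln1.
rewrite -cardsX; apply/subset_leq_card/subsetP => _ /imsetP[y _ ->].
by rewrite !inE /= andbT; have := shift_sol y; rewrite inE.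
Qed.

End DotProducts.

(** * Realizing prescribed dot products along an elimination order *)

Lemma isolated_count_bound N d s l : 1 < d -> l.+1 < 2 ^ N.+1 ->
  N + 2 * d <= s + 3 -> 1 + l * (2 ^ d.-1 - 1) < 2 ^ s.
Proof.
case: d => [|[|d]] // _ lN dim_s.
apply: (@leq_trans (2 ^ (N.+1 + d * 2))); last by rewrite leq_exp2l //; lia.
rewrite expnD expnM [2 ^ d.+1]expnS; have : 0 < 2 ^ d by rewrite expn_gt0.
move: (2 ^ d) (2 ^ N.+1) lN => c b l_lt_b c_gt0; rewrite -mulnn.
apply: (@leq_ltn_trans (l.+1 * (c * c))); last first.
  by rewrite ltn_mul2r l_lt_b muln_gt0 c_gt0.
by rewrite mulSn leq_add ?muln_gt0 ?c_gt0 // leq_mul2l; apply/orP; right; nia.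
Qed.

Lemma removable_count_bound N d s m p e : 1 < N -> 1 < d -> 0 < m -> 0 < p ->
    e + m * p <= d -> N + 2 * d <= s + 3 ->
  (2 ^ m.-1 + e * 2 ^ d.-1) * 2 ^ p < 2 ^ s.
Proof.
move=> N_gt1 d_gt1 m_gt0 p_gt0 emp dim_s; have pd : p <= d by nia.
apply: (@leq_trans (2 ^ (d.-1 + (d - p) + p))); last first.
  by rewrite leq_exp2l //; lia.
rewrite expnD ltn_mul2r expn_gt0 /= expnD.
have [md|dm] := ltnP m d.
  have lt_m : 2 ^ m.-1 < 2 ^ d.-1 by rewrite ltn_exp2l //; lia.
  have lt_e : e < 2 ^ (d - p) by apply: leq_ltn_trans (ltn_expl _ _) => //; nia.
  apply: (@leq_trans (e.+1 * 2 ^ d.-1)); first by rewrite mulSn ltn_add2r.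
  by rewrite mulnC leq_mul2l lt_e orbT.
have [-> [-> ->]] : e = 0 /\ m = d /\ p = 1 by nia.
by rewrite addn0 ltn_Pmulr ?expn_gt0 // -{1}(expn0 2) ltn_exp2l //; lia.
Qed.

Lemma leq_card_bigcup (I T : finType) (P : {pred I}) (F : I -> {set T}) :
  #|\bigcup_(i in P) F i| <= \sum_(i in P) #|F i|.
Proof.
elim/big_rec2: _ => [|i n A _ le_n]; first by rewrite cards0.
by apply: leq_trans (leq_card_setU _ _) _; rewrite leq_add2l.
Qed.

Section Realization.
Variables (T : finType) (adj : rel T) (d : nat).
Hypotheses (adj_sym : symmetric adj) (adj_irr : irreflexive adj).
Implicit Types (S X J : {set T}) (v w : T).

Definition nbr v : {set T} := [set u | adj v u].

(* The neighbours in [S] of any other neighbour of [v] outside [S] all lie in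
   [X :&: S], so the unexceptional neighbours share one small forbidden span. *)
Definition exceptional S X v : {set T} :=
  [set w in nbr v :\: S | (w \notin X) || ~~ (nbr w :&: S \subset X)].

Definition removable S v : bool :=
  (nbr v :&: S == set0) ||
  [exists X : {set T}, (v \in X) &&
    (#|exceptional S X v| + #|X :&: S| * #|nbr v :&: S| <= d)].

Lemma nbr_setD1 S v : nbr v :&: (S :\ v) = nbr v :&: S.
Proof.
by apply/setP => u; rewrite !inE; case: eqVneq => [->|//]; rewrite adj_irr.
Qed.

Lemma card_nbr_removable S v : v \in S -> removable S v -> #|nbr v :&: S| <= d.
Proof.
move=> vS /orP[/eqP->|/existsP[X /andP[vX]]]; first by rewrite cards0.
have : 0 < #|X :&: S| by apply/card_gt0P; exists v; rewrite inE vX.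
by clear; nia.
Qed.

Section Vectors.
Variables (s : nat) (a : T -> T -> bool).
Hypothesis a_sym : forall u v, a u v = a v u.
Implicit Types (z : T -> 'rV[bool]_s) (y : 'rV[bool]_s).

Definition realizes S z : Prop :=
  {in S &, forall u v, adj u v -> dot (z u) (z v) = a u v}.

Definition free_outside S z : Prop :=
  forall w, w \notin S -> free_on z (nbr w :&: S).

(* The values of [z v] that would break the freeness at a vertex outside [S]. *)
Definition forbidden z S v : {set 'rV[bool]_s} :=
  \bigcup_(w in nbr v :\: S) spanned z (nbr w :&: (S :\ v)).

Lemma extend_realization z S v y : v \in S -> realizes (S :\ v) z ->
    free_outside (S :\ v) z ->
    {in nbr v :&: S, forall u, dot y (z u) = a v u} ->
    y \notin forbidden z S v ->
  exists2 z', realizes S z' & free_outside S z'.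
Proof.
move=> vS real_z free_z y_nbr y_allowed.
pose z' u := if u == v then y else z u; have z'v : z' v = y by rewrite /z' eqxx.
have z'z J : v \notin J -> {in J, z' =1 z}.
  by move=> vJ u uJ; rewrite /z' ifN //; apply: contraNneq vJ => <-.
exists z' => [u w uS wS uw|w wS].
  have [uv|uv] := eqVneq u v; have [wv|wv] := eqVneq w v.
  + by rewrite uv wv adj_irr in uw.
  + by rewrite /z' uv eqxx (negbTE wv) y_nbr // !inE -uv uw wS.
  + rewrite /z' wv eqxx (negbTE uv) dotC a_sym y_nbr // !inE adj_sym.
    by rewrite -wv uw uS.
  + by rewrite /z' (negbTE uv) (negbTE wv) real_z // !inE ?uv ?wv.
have vD : v \notin nbr w :&: (S :\ v) by rewrite !inE eqxx andbF.
have free_w : free_on z' (nbr w :&: (S :\ v)).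
  rewrite (eq_free_on (z'z _ vD)); apply: free_z.
  by rewrite !inE (negbTE wS) andbF.
have [vw|nvw] := boolP (adj w v).
  have -> : nbr w :&: S = v |: (nbr w :&: (S :\ v)).
    by apply/setP => u; rewrite !inE; case: eqVneq => [->|]; rewrite ?vw.
  rewrite free_on_setU1 // free_w andbT z'v (eq_spanned (z'z _ vD)).
  apply: contra y_allowed => yw; apply/bigcupP; exists w => //.
  by rewrite !inE wS adj_sym.
suff <- : nbr w :&: (S :\ v) = nbr w :&: S by [].
by apply/setP => u; rewrite !inE; case: eqVneq => [->|]; rewrite ?(negbTE nvw).
Qed.

Lemma card_nbr_outside S v w : v \in S -> w \in nbr v :\: S ->
  #|nbr w :&: S| <= d -> #|nbr w :&: (S :\ v)| <= d.-1.
Proof.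
move=> vS; rewrite !inE => /andP[_ vw].
rewrite (cardsD1 v (nbr w :&: S)) !inE adj_sym vw vS -setIDA; clear; lia.
Qed.

Variable N : nat.
Hypotheses (N_gt1 : 1 < N) (d_gt1 : 1 < d) (T_lt : #|T| < 2 ^ N.+1).
Hypothesis dim_s : N + 2 * d <= s + 3.

Section Forbidden.
Variables (z : T -> 'rV[bool]_s) (S : {set T}) (v : T).
Hypotheses (vS : v \in S) (degS : forall w, w \notin S -> #|nbr w :&: S| <= d).

Lemma card_spanned_nbr w : w \in nbr v :\: S ->
  #|spanned z (nbr w :&: (S :\ v))| <= 2 ^ d.-1.
Proof.
move=> wvS; apply: leq_trans (card_spanned _ _) _.
rewrite card_bool leq_exp2l //; apply: card_nbr_outside => //.
by apply: degS; case/setDP: wvS.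
Qed.

(* The spans share the zero vector, which is counted once. *)
Lemma card_forbidden_isolated : #|forbidden z S v| < 2 ^ s.
Proof.
have nbr_lt : #|nbr v|.+1 < 2 ^ N.+1.
  apply: leq_ltn_trans T_lt; apply: leq_trans (max_card (mem (v |: nbr v))).
  by rewrite cardsU1 inE adj_irr.
apply: leq_ltn_trans (isolated_count_bound d_gt1 nbr_lt dim_s).
have sub0 : forbidden z S v \subset
    0%R |: \bigcup_(w in nbr v :\: S) (spanned z (nbr w :&: (S :\ v)) :\ 0%R).
  apply/subsetP => y /bigcupP[w wv yw]; rewrite in_setU1.
  have [//|y0] := eqVneq y 0%R.
  by apply/bigcupP; exists w; rewrite // in_setD1 y0.
apply: leq_trans (subset_leq_card sub0) _; rewrite cardsU1.
apply: leq_add; first by case: (_ \notin _).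
apply: leq_trans (leq_card_bigcup _ _) _.
apply: (@leq_trans (\sum_(w in nbr v :\: S) (2 ^ d.-1 - 1))).
  apply: leq_sum => w /card_spanned_nbr le_w.
  rewrite subn1 -ltnS prednK ?expn_gt0 //.
  by move: le_w; rewrite (cardsD1 0%R) spanned0.
by rewrite sum_nat_const leq_mul2r subset_leq_card ?subsetDl ?orbT.
Qed.

Lemma card_forbidden_exceptional X : v \in X ->
  #|forbidden z S v| <= 2 ^ #|X :&: S|.-1 + #|exceptional S X v| * 2 ^ d.-1.
Proof.
move=> vX; have subX : forbidden z S v \subset spanned z ((X :&: S) :\ v) :|:
    \bigcup_(w in exceptional S X v) spanned z (nbr w :&: (S :\ v)).
  apply/subsetP => y /bigcupP[w wv yw]; rewrite in_setU.
  have [wE|wE] := boolP (w \in exceptional S X v).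
    by apply/orP; right; apply/bigcupP; exists w.
  apply/orP; left; move: yw; apply/subsetP/spannedS.
  move: wE; rewrite inE wv /= negb_or !negbK => /andP[_ sX].
  by rewrite setIDA setSD // subsetI sX subsetIr.
apply: leq_trans (subset_leq_card subX) _.
apply: leq_trans (leq_card_setU _ _) _; apply: leq_add.
  apply: leq_trans (card_spanned _ _) _; rewrite card_bool.
  by rewrite (cardsD1 v (X :&: S)) inE vX vS.
apply: leq_trans (leq_card_bigcup _ _) _.
rewrite -sum_nat_const; apply: leq_sum => w.
by rewrite inE => /andP[/card_spanned_nbr].
Qed.

Lemma card_forbidden : removable S v ->
  #|forbidden z S v| * 2 ^ #|nbr v :&: S| < 2 ^ s.
Proof.
have [nbr0|nbr_gt0] := posnP #|nbr v :&: S|.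
  by rewrite nbr0 muln1 => _; exact: card_forbidden_isolated.
case/orP => [/eqP nbr0|/existsP[X /andP[vX leX]]].
  by rewrite nbr0 cards0 in nbr_gt0.
have X_gt0 : 0 < #|X :&: S| by apply/card_gt0P; exists v; rewrite inE vX.
have := removable_count_bound N_gt1 d_gt1 X_gt0 nbr_gt0 leX dim_s.
apply: leq_ltn_trans.
by rewrite leq_mul2r card_forbidden_exceptional ?orbT.
Qed.

End Forbidden.

Hypothesis elimination : forall S, S != set0 ->
  exists2 v, v \in S & removable S v.

Lemma exists_realization_on S : (forall w, w \notin S -> #|nbr w :&: S| <= d) ->
  exists2 z, realizes S z & free_outside S z.
Proof.
have [c] := ubnP #|S|; elim: c S => // c IH S leS degS.
have [->|S_neq0] := eqVneq S set0.
  exists (fun=> 0%R) => [u|w _]; first by rewrite inE.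
  by rewrite setI0 /free_on /image_mem enum_set0 nil_free.
have [v vS rem_v] := elimination S_neq0.
have [|w|z real_z free_z] := IH (S :\ v).
- by move: leS; rewrite (cardsD1 v S) vS.
- rewrite !inE negb_and negbK => /orP[/eqP ->|/degS].
    by rewrite nbr_setD1; exact: card_nbr_removable.
  by apply: leq_trans; rewrite subset_leq_card // setIS ?subD1set.
have vD : v \notin S :\ v by rewrite !inE eqxx.
have solutions := card_dot_solutions (a v) (free_z v vD).
rewrite nbr_setD1 card_bool in solutions.
have /subsetPn[y] :
    ~~ ([set y | [forall u in nbr v :&: S, dot y (z u) == a v u]]
          \subset forbidden z S v).
  apply: contraL (card_forbidden z vS degS rem_v) => /subset_leq_card le_sol.
  rewrite -leqNgt; apply: leq_trans solutions _.
  by rewrite leq_mul2r le_sol orbT.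
rewrite inE => /forall_inP y_sol; apply: extend_realization vS real_z free_z _.
by move=> u /y_sol/eqP.
Qed.

Lemma exists_realization :
  exists z : T -> 'rV[bool]_s, forall u v, adj u v -> dot (z u) (z v) = a u v.
Proof.
have [w|z real_z _] := @exists_realization_on setT; first by rewrite inE.
by exists z => u v; apply: real_z; rewrite inE.
Qed.

End Vectors.
End Realization.

(* The counting argument needs order at least 4. In order 3 any three dot
   products are realized in dimension 2. *)
Lemma exists_realization_order n k (adj : rel 'I_n) (a : 'I_n -> 'I_n -> bool) :
    0 < k -> k + 2 <= n -> symmetric adj -> irreflexive adj ->
    (forall S, S != set0 -> exists2 v, v \in S & removable adj (2 * k) S v) ->
    (forall u v, a u v = a v u) ->
  exists z : 'I_n -> 'rV[bool]_(trunc_log 2 n + 4 * k - 3),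
    forall u v, adj u v -> dot (z u) (z v) = a u v.
Proof.
move=> k_gt0 kn adj_sym adj_irr elimination a_sym.
have [n_gt3|n_le3] := ltnP 3 n.
  have realizable :=
    exists_realization (N := trunc_log 2 n) adj_sym adj_irr a_sym.
  apply: realizable elimination.
  - exact: trunc_log_max.
  - by lia.
  - by rewrite card_ord trunc_log_ltn.
  - by lia.
have [n3 k1] : n = 3 /\ k = 1 by lia.
subst n k; have [z gram_z] := exists_offdiagonal_gram a_sym.
exists z => u v uv; apply: gram_z.
by apply: contraTneq uv => ->; rewrite adj_irr.
Qed.

(** * Elimination orders from tight sets *)

Section TightSubset.
Variables (T : finType) (K : nat) (A : {set T}) (G : seq (T * T)).
Implicit Types (H B : {set T * T}).

Lemma perm_enum_setD1 H e : e \in H ->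
  perm_eq (enum H ++ G) (e :: enum (H :\ e) ++ G).
Proof.
move=> eH; rewrite -cat_cons perm_cat2r; apply: uniq_perm => [||f].
- exact: enum_uniq.
- by rewrite /= mem_enum setD11 enum_uniq.
- by rewrite inE !mem_enum in_setD1; case: eqVneq => [->|].
Qed.

Lemma exists_tight_subset B : connected_on K A (enum B ++ G) ->
  exists H, [/\ H \subset B, connected_on K A (enum H ++ G) &
    {in H, forall e, tight_edge K A (enum H ++ G) e}].
Proof.
move=> conB; pose conn H := connected_on K A (enum H ++ G).
have [H /minsetP[conH minH] HB] := @minset_exists _ conn B conB.
exists H; split=> // e eH; have pe := perm_enum_setD1 eH.
move: (conH); rewrite (perm_tight_edge _ _ pe) /conn (perm_connected_on _ _ pe).
case/connected_on_cons/orP => // /(minH (H :\ e))/(_ (subsetDl _ _)) eqH.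
by move: eH; rewrite -eqH setD11.
Qed.

End TightSubset.

Section EliminationOrder.
Variables (T : finType) (H : {set T * T}) (G : seq (T * T)) (K : nat).
Implicit Types (X S : {set T}) (u v x y : T).

Definition adj : rel T := fun u v => ((u, v) \in H) || ((v, u) \in H).

Lemma adj_sym : symmetric adj.
Proof. by move=> u v; rewrite /adj orbC. Qed.

Definition leaving_pairs X : {set T * T} :=
  [set p : T * T | adj p.1 p.2 && leaves X p].

Lemma card_leaving_pairs X : #|leaving_pairs X| <= cut (enum H) X.
Proof.
rewrite cut_leaves !count_enum; set out := [set _ in H | leaves X _].
set into := [set _ in H | _]; pose swap := @flip T.
have sub : leaving_pairs X \subset out :|: [set swap p | p in into].
  apply/subsetP => -[x y]; rewrite !inE => /andP[/orP[xyH|yxH] xyX].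
    by rewrite xyH xyX.
  apply/orP; right; apply/imsetP; exists (y, x) => //.
  by rewrite inE yxH /= -leaves_flip.
apply: leq_trans (subset_leq_card sub) _.
by rewrite (leq_trans (leq_card_setU _ _)) // leq_add2l leq_imset_card.
Qed.

Section Removable.
Variables (S X : {set T}) (v : T).

Lemma card_leaving_pairs_in m :
    {in X :&: S &, forall x y, ~~ adj x y} ->
    {in X :&: S, forall x, m <= #|nbr adj x :&: S|} ->
  #|X :&: S| * m <= #|leaving_pairs X :&: setX S S|.
Proof.
move=> stableX le_nbr.
apply: (@leq_trans (\sum_(x in X :&: S) \sum_(y in nbr adj x :&: S) 1)).
  by rewrite -sum_nat_const; apply: leq_sum => x /le_nbr; rewrite sum1_card.
rewrite pair_big_dep /= sum1_card; apply/subset_leq_card/subsetP => -[x y].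
rewrite unfold_in /= !inE /leaves /= => /andP[/andP[xX xS] /andP[xy yS]].
rewrite xy xX xS yS !andbT /=; apply: contraL xy => yX.
by apply: stableX; rewrite inE ?xX ?yX.
Qed.

Lemma card_exceptional_leq : v \in X :&: S ->
  #|exceptional adj S X v| <= #|leaving_pairs X :\: setX S S|.
Proof.
case/setIP => vX vS.
pose g w := if w \in X then (w, odflt v [pick y in (nbr adj w :&: S) :\: X])
            else (v, w).
rewrite -(card_in_imset (f := g)).
  apply/subset_leq_card/subsetP => _ /imsetP[w + ->]; rewrite !inE /g /leaves.
  case/andP => /andP[wS vw]; have [wX /=|wX _] := boolP (w \in X); last first.
    by rewrite /= vw vX wX (negbTE wS) vS.
  move=> /subsetPn[y]; rewrite !inE => /andP[wy yS] yX.
  case: pickP => [y'|/(_ y)]; last by rewrite !inE wy yS yX.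
  rewrite !inE /= => /and3P[y'X wy' y'S].
  by rewrite wy' wX y'X (negbTE wS).
move=> w1 w2; rewrite !inE /g => /andP[/andP[w1S _] _] /andP[/andP[w2S _] _].
by case: ifP; case: ifP => _ _ [] // eq_v;
  [rewrite eq_v vS in w1S | rewrite -eq_v vS in w2S].
Qed.

End Removable.

Notation E := (enum H ++ G).
Hypothesis conE : connected_on K setT E.
Hypothesis tightH : {in H, forall e, tight_edge K setT E e}.

Lemma adj_tight_edge u v : adj u v ->
  exists2 e, tight_edge K setT E e & e = (u, v) \/ e = (v, u).
Proof. by case/orP => /tightH; [exists (u, v) | exists (v, u)]; auto. Qed.

Lemma exists_tight_stable S u v : u \in S -> v \in S -> adj u v ->
  exists X, [/\ tight K setT E X, X :&: S != set0 &
    {in X :&: S &, forall x y, ~~ adj x y}].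
Proof.
move=> uS vS uv; have meetsS : exists X, tight K setT E X && (X :&: S != set0).
  have [e /existsP[X /andP[tX eX]] e_uv] := adj_tight_edge uv.
  exists X; rewrite tX; apply: crosses_meets eX; by case: e_uv => ->.
have [X [tX XS indX]] := exists_tight_independent conE (subsetT S) meetsS.
exists X; split=> // x y xXS yXS; apply/negP => /adj_tight_edge[e /indX + e_xy].
by case: e_xy => ->; rewrite /= xXS yXS.
Qed.

(* Choose [v] of least degree in a tight stable [X :&: S]: the [H]-edges
   leaving [X], at most [K] of them, account for both terms of the bound. *)
Lemma exists_removable S :
  S != set0 -> exists2 v, v \in S & removable adj K S v.
Proof.
case/set0Pn => v0 v0S.
case: (pickP (fun p : T * T => [&& p.1 \in S, p.2 \in S & adj p.1 p.2]));
  last first.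
  move=> no_edge; exists v0 => //; apply/orP; left; apply/eqP/setP => w.
  rewrite !inE; apply/negbTE/negP => /andP[vw wS].
  by have := no_edge (v0, w); rewrite /= v0S wS vw.
move=> [u u'] /= /and3P[uS u'S uu'].
have [X [tX X_S stableX]] := exists_tight_stable uS u'S uu'.
have /set0Pn[x0 x0X] := X_S.
case: (@arg_minnP _ x0 (mem (X :&: S)) (fun v => #|nbr adj v :&: S|) x0X).
move=> v vXS min_v; have /setIP[vX vS] : v \in X :&: S by [].
exists v => //; apply/orP; right; apply/existsP; exists X; rewrite vX /=.
apply: (@leq_trans #|leaving_pairs X|).
  rewrite -(cardsID (setX S S)) addnC.
  by rewrite leq_add ?card_exceptional_leq // card_leaving_pairs_in.
case/andP: tX => _ /eqP <-; rewrite cut_cat.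
exact: leq_trans (card_leaving_pairs X) (leq_addr _ _).
Qed.

End EliminationOrder.

(** * The upper bound *)

Section Arcs.
Variables (n : nat) (D : rel 'I_n).
Implicit Types (X : {set 'I_n}) (p : 'I_n * 'I_n).

Definition arcs : seq ('I_n * 'I_n) :=
  enum [set p : 'I_n * 'I_n | D p.1 p.2].

Lemma mem_arcs p : (p \in arcs) = D p.1 p.2.
Proof. by rewrite mem_enum inE. Qed.

Lemma narcsE X : narcs D X (~: X) = count (leaves X) arcs.
Proof. by rewrite count_enum; apply: eq_card => p; rewrite !inE. Qed.

Lemma edge_connectedP m : edge_connected m D <-> connected_on m setT arcs.
Proof.
split=> [conD|/connected_onP conD X X0 X1].
  apply/connected_onP => X; rewrite separatesT => /andP[X0 X1].
  by rewrite cut_leaves -!narcsE setCK; exact: conD.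
have := conD X; rewrite separatesT X0 X1 cut_leaves -!narcsE setCK.
by apply.
Qed.

Lemma arc_strongP k :
  arc_strong k D <-> forall X, separates X setT -> k <= count (leaves X) arcs.
Proof.
split=> strong X => [|X0 X1]; last by rewrite narcsE strong // separatesT X0.
by rewrite separatesT -narcsE => /andP[]; exact: strong.
Qed.

Definition single_arcs : {set 'I_n * 'I_n} :=
  [set p : 'I_n * 'I_n | D p.1 p.2 && ~~ D p.2 p.1].

Definition digons : seq ('I_n * 'I_n) :=
  enum [set p : 'I_n * 'I_n | D p.1 p.2 && D p.2 p.1].

Lemma mem_digons p : (p \in digons) = D p.1 p.2 && D p.2 p.1.
Proof. by rewrite mem_enum inE. Qed.

Lemma perm_arcs : perm_eq arcs (enum single_arcs ++ digons).
Proof.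
apply: uniq_perm => [||p]; first exact: enum_uniq.
  rewrite cat_uniq !enum_uniq andbT; apply/hasPn => p.
  by rewrite mem_digons mem_enum inE => /andP[-> ->].
by rewrite mem_cat mem_arcs mem_digons mem_enum inE; do 2!case: (D _ _).
Qed.

Lemma count_digonsC X : count (leaves (~: X)) digons = count (leaves X) digons.
Proof.
have flip_digons : perm_eq (map (@flip _) digons) digons.
  have flip_inj := can_inj (@flipK 'I_n).
  apply: uniq_perm => [||p]; rewrite ?(map_inj_uniq flip_inj) ?enum_uniq //.
  by rewrite -{1}[p]flipK (mem_map flip_inj) !mem_digons andbC.
rewrite -(permP flip_digons (leaves X)) count_map.
by apply: eq_count => p; rewrite /= leaves_flip.
Qed.

Lemma cut_digons X : cut digons X = 2 * count (leaves X) digons.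
Proof. by rewrite cut_leaves count_digonsC addnn mul2n. Qed.

End Arcs.

Definition shared_count n (Xs : seq {set 'I_n}) u v : nat :=
  count (fun X : {set 'I_n} => (u \in X) && (v \in X)) Xs.

Lemma shared_countC n (Xs : seq {set 'I_n}) u v :
  shared_count Xs u v = shared_count Xs v u.
Proof. by apply: eq_count => X; rewrite andbC. Qed.

Lemma inv_familyE n (D : rel 'I_n) Xs u v :
  inv_family D Xs u v = if odd (shared_count Xs u v) then D v u else D u v.
Proof. by []. Qed.

Section Realignment.
Variables (n : nat) (D : rel 'I_n).
Variables (H : {set 'I_n * 'I_n}) (F : seq ('I_n * 'I_n)).
Hypothesis H_single : H \subset single_arcs D.
Hypothesis orientsF : orients (enum H) F.

Lemma mem_single p : p \in H -> D p.1 p.2 /\ ~~ D p.2 p.1.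
Proof. by move/(subsetP H_single); rewrite inE => /andP. Qed.

Lemma uniq_ends_single : uniq (map (@ends _) (enum H)).
Proof.
rewrite map_inj_in_uniq ?enum_uniq // => e f; rewrite !mem_enum.
move=> /mem_single[_ /negP nD] /mem_single[Df _] /eqP/ends_eqP[//|fE].
by rewrite fE in Df.
Qed.

Lemma oriented_single p : p \in F -> D p.2 p.1 = ~~ D p.1 p.2.
Proof.
move=> /(mem_orients orientsF); rewrite !mem_enum.
by case/orP => /mem_single /= [-> /negbTE ->].
Qed.

Lemma oriented_asym p : p \in F -> flip p \notin F.
Proof.
move=> pF; apply/negP => /(orients_asym orientsF uniq_ends_single pF) eq_flip.
by have := oriented_single pF; rewrite -{1 2}eq_flip /=; case: (D _ _).
Qed.

Definition misaligned u v : bool :=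
  ((u, v) \in F) && ~~ D u v || ((v, u) \in F) && ~~ D v u.

Lemma misalignedC u v : misaligned u v = misaligned v u.
Proof. exact: orbC. Qed.

Lemma inv_family_realigned Xs :
    (forall u v, adj H u v -> odd (shared_count Xs u v) = misaligned u v) ->
  {subset F ++ digons D <= arcs (inv_family D Xs)}.
Proof.
move=> inv_misaligned [u v]; rewrite mem_cat mem_arcs inv_familyE /=.
case/orP => [uvF|]; last by rewrite mem_digons /=; case: ifP => _ /andP[].
have uv : adj H u v by have := mem_orients orientsF uvF; rewrite !mem_enum.
have vuF := negbTE (oriented_asym uvF); have /= vuD := oriented_single uvF.
by rewrite inv_misaligned // /misaligned uvF vuF orbF vuD /=; case: (D u v).
Qed.

Lemma uniq_oriented_digons : uniq (F ++ digons D).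
Proof.
rewrite cat_uniq (orients_uniq orientsF uniq_ends_single) enum_uniq andbT.
apply/hasPn => p; rewrite mem_digons; apply: contraL => pF.
by rewrite (oriented_single pF); case: (D _ _).
Qed.

End Realignment.

Definition coordinate_sets n s (z : 'I_n -> 'rV[bool]_s) : seq {set 'I_n} :=
  [seq [set v | z v ord0 i] | i <- enum 'I_s].

Lemma odd_count (I : Type) (a : pred I) (r : seq I) :
  odd (count a r) = (\sum_(i <- r) a i)%R.
Proof.
by elim: r => [|i r IH]; rewrite ?big_nil // big_cons /= oddD oddb IH.
Qed.

Lemma odd_shared_count_coordinate_sets n s (z : 'I_n -> 'rV[bool]_s) u v :
  odd (shared_count (coordinate_sets z) u v) = dot (z u) (z v).
Proof.
rewrite /shared_count count_map odd_count big_enum dotE.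
by apply: eq_bigr => i _; rewrite /= !inE.
Qed.

Lemma inversion_upper_bound n k (D : rel 'I_n) : 0 < k -> k + 2 <= n ->
    loopless D -> edge_connected (2 * k) D ->
  exists2 Xs : seq {set 'I_n},
    size Xs <= trunc_log 2 n + 4 * k - 3 & arc_strong k (inv_family D Xs).
Proof.
move=> k_gt0 kn D_irr /edge_connectedP.
rewrite (perm_connected_on _ _ (perm_arcs D)).
case/exists_tight_subset => H [H_single conH tightH].
have edgesH : edges_in setT (enum H ++ digons D).
  rewrite /edges_in all_cat; apply/andP; split; apply/allP => -[u v].
    rewrite mem_enum !inE /= => /(mem_single H_single)[/= uv _].
    by apply: contraTneq uv => ->; rewrite D_irr.
  rewrite mem_digons !inE /= => /andP[uv _].
  by apply: contraTneq uv => ->; rewrite D_irr.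
have [|||F orientsF strongF] := exists_strong_orientation _ _ edgesH conH.
- by rewrite mul2n odd_double.
- by rewrite muln_gt0.
- by move=> X; rewrite cut_digons mul2n odd_double.
have adj_irr : irreflexive (adj H).
  move=> v; rewrite /adj orbb; apply/negP => /(mem_single H_single)[].
  by rewrite D_irr.
have [z real_z] := exists_realization_order k_gt0 kn (adj_sym H) adj_irr
  (exists_removable conH tightH) (misalignedC D F).
exists (coordinate_sets z); first by rewrite size_map size_enum_ord.
apply/arc_strongP => X sepX.
have realigned :
    {subset F ++ digons D <= arcs (inv_family D (coordinate_sets z))}.
  apply: (inv_family_realigned H_single orientsF) => u v uv.
  by rewrite odd_shared_count_coordinate_sets; exact: real_z.
have uniqFD := uniq_oriented_digons H_single orientsF.
apply: leq_trans (count_uniq_sub (leaves X) uniqFD realigned).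
by have := strongF X sepX; rewrite cut_digons -mulnDr leq_mul2l count_cat.
Qed.

(** * The lower bound *)

Definition min_semidegree_ge n (D : rel 'I_n) k : Prop := forall v,
  k <= #|[set w | D v w]| /\ k <= #|[set w | D w v]|.

Lemma arc_strong_min_semidegree n k (D : rel 'I_n) :
  1 < n -> arc_strong k D -> min_semidegree_ge D k.
Proof.
move=> n_gt1 strong v.
have v0 : [set v] != set0 by apply/set0Pn; exists v; rewrite inE.
have vC0 : ~: [set v] != set0.
  by rewrite -card_gt0 cardsCs setCK cards1 card_ord subn_gt0.
split.
  apply: leq_trans (strong _ v0 vC0) (leq_trans _ (leq_imset_card (pair v) _)).
  apply/subset_leq_card/subsetP => -[u w].
  rewrite !inE => /and3P[/= uw /eqP <- _].
  by apply/imsetP; exists w; rewrite ?inE.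
have := strong (~: [set v]); rewrite setCK => /(_ vC0 v0) k_le.
apply: leq_trans k_le (leq_trans _ (leq_imset_card (pair^~ v) _)).
apply/subset_leq_card/subsetP => -[w u].
rewrite !inE => /and3P[/= wu _ /eqP <-].
by apply/imsetP; exists w; rewrite ?inE.
Qed.

Section UniversalVertex.
Variables (n : nat) (D : rel 'I_n).
Implicit Types (X : {set 'I_n.+1}) (Xs : seq {set 'I_n.+1}).

Definition add_universal : rel 'I_n.+1 := fun u v =>
  if (unlift ord0 u, unlift ord0 v) is (Some u', Some v') then D u' v'
  else u != v.

Let lift0 : 'I_n -> 'I_n.+1 := lift ord0.

Lemma add_universal_lift u v : add_universal (lift0 u) (lift0 v) = D u v.
Proof. by rewrite /add_universal !liftK. Qed.

Lemma add_universal0l v : add_universal ord0 v = (ord0 != v).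
Proof. by rewrite /add_universal unlift_none. Qed.

Lemma add_universal0r u : add_universal u ord0 = (u != ord0).
Proof. by rewrite /add_universal unlift_none; case: (unlift _ u). Qed.

Lemma add_universal_loopless : loopless D -> loopless add_universal.
Proof.
move=> D_irr v; have [v'|] := unliftP ord0 v => ->.
  by rewrite add_universal_lift.
by rewrite add_universal0l eqxx.
Qed.

Lemma cut_add_universal X : ord0 \notin X ->
  cut (arcs D) (lift0 @^-1: X) + 2 * #|X| <= cut (arcs add_universal) X.
Proof.
move=> X0; pose lift_arc (p : 'I_n * 'I_n) := (lift0 p.1, lift0 p.2).
have lift_arc_inj : injective lift_arc.
  by move=> [a b] [c d] /eqP/andP[/eqP/lift_inj /= -> /eqP/lift_inj /= ->].
pose old := map lift_arc (arcs D).
pose spokes := [seq (ord0 : 'I_n.+1, v) | v <- enum X].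
have cut_old : cut old X = cut (arcs D) (lift0 @^-1: X).
  by rewrite /cut count_map; apply: eq_count => p; rewrite /crosses /= !inE.
have cut_spokes : cut spokes X = #|X|.
  rewrite cardE -(size_map (pair (ord0 : 'I_n.+1))); apply/eqP.
  rewrite -all_count all_map; apply/allP => v.
  by rewrite mem_enum /= /crosses /= (negbTE X0).
have uniq_new : uniq (old ++ spokes ++ map (@flip _) spokes).
  have uniq_old : uniq old by rewrite map_inj_uniq ?enum_uniq.
  have uniq_spokes : uniq spokes.
    by rewrite map_inj_uniq ?enum_uniq // => v w [].
  rewrite !cat_uniq uniq_old uniq_spokes (map_inj_uniq (can_inj (@flipK _))).
  rewrite uniq_spokes andbT; apply/and3P; split=> //; apply/hasPn => p.
    move=> spoke_p; apply/mapP => -[q _ eq_p].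
    have : (p.1 == ord0) || (p.2 == ord0).
      move: spoke_p; rewrite mem_cat.
      by case/orP => [/mapP[v _ ->]|/mapP[r /mapP[v _ ->] ->]];
        rewrite /= ?eqxx ?orbT.
    by rewrite eq_p /= ![lift0 _ == _]eq_sym !(negbTE (neq_lift _ _)).
  move=> /mapP[q /mapP[v]] + -> ->; rewrite mem_enum => vX.
  by apply: contra X0 => /mapP[w _ [v0 _]]; rewrite -v0.
have sub_new :
    {subset old ++ spokes ++ map (@flip _) spokes <= arcs add_universal}.
  move=> p; rewrite !mem_cat mem_arcs.
  case/or3P => [/mapP[q]|/mapP[v]|/mapP[q /mapP[v]]].
  - by rewrite mem_arcs => Dq ->; rewrite add_universal_lift.
  - rewrite mem_enum => vX ->; rewrite add_universal0l.
    by apply: contraNneq X0 => ->.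
  - rewrite mem_enum => vX -> ->; rewrite add_universal0r.
    by apply: contraNneq X0 => <-.
apply: leq_trans (count_uniq_sub (crosses X) uniq_new sub_new).
rewrite !count_cat -!/(cut _ X) cut_old cut_spokes mul2n -addnn.
rewrite !leq_add2l -{1}cut_spokes /cut [in X in _ <= X]count_map.
by rewrite (eq_count (crosses_flip X)).
Qed.

Lemma add_universal_connected k : k < n ->
  edge_connected (2 * k) D -> edge_connected (2 * k.+1) add_universal.
Proof.
move=> kn /edge_connectedP/connected_onP conD.
apply/edge_connectedP/connected_onP => X; wlog X0 : X / ord0 \notin X.
  move=> away; have [X0|/away //] := boolP (ord0 \in X).
  by rewrite -separatesC -cutC; apply: away; rewrite inE X0.
rewrite separatesT => /andP[Xn0 _]; apply: leq_trans (cut_add_universal X0).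
have X_gt0 : 0 < #|X| by rewrite card_gt0.
have [X'sep|] := boolP (separates (lift0 @^-1: X) setT).
  by rewrite mulnS addnC leq_add ?conD ?leq_pmulr.
rewrite separatesT negb_and !negbK => X'trivial.
have X'T : lift0 @^-1: X = setT.
  have /set0Pn[u uX] := Xn0.
  case: (unliftP ord0 u) uX => [u'|] -> uX; last by rewrite uX in X0.
  case/orP: X'trivial => /eqP X'0; last by rewrite -[LHS]setCK X'0 setC0.
  by have := in_set0 u'; rewrite -X'0 inE uX.
have le_nX : n <= #|X|.
  apply: (@leq_trans #|[set lift0 v | v in 'I_n]|).
    by rewrite card_imset ?card_ord //; exact: lift_inj.
  apply/subset_leq_card/subsetP => _ /imsetP[v _ ->].
  by have := in_setT v; rewrite -X'T inE.
apply: leq_trans (leq_addl _ _).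
by rewrite leq_mul2l /= (leq_trans kn).
Qed.

Definition restrict_sets Xs : seq {set 'I_n} :=
  [seq lift0 @^-1: X | X <- Xs].

Lemma inv_family_add_universal Xs u v :
  inv_family add_universal Xs (lift0 u) (lift0 v) =
  inv_family D (restrict_sets Xs) u v.
Proof.
rewrite !inv_familyE !add_universal_lift /shared_count count_map.
by congr (if odd _ then _ else _); apply: eq_count => X; rewrite /= !inE.
Qed.

Lemma ltn_card_lift0 k (P : pred 'I_n.+1) (Q : pred 'I_n) :
    (forall w, P (lift0 w) = Q w) ->
  k < #|[set w | P w]| -> k <= #|[set w | Q w]|.
Proof.
move=> PQ lt_k; rewrite -ltnS; apply: leq_trans lt_k _.
rewrite (cardsD1 ord0) -[leqRHS]add1n leq_add //; first by case: (_ \in _).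
apply: leq_trans (leq_imset_card lift0 _); apply/subset_leq_card/subsetP => w.
rewrite !inE; case: (unliftP ord0 w) => [w'|] ->; rewrite ?eqxx //= => Pw.
by apply/imsetP; exists w'; rewrite // inE -PQ.
Qed.

Lemma min_semidegree_add_universal k Xs :
  min_semidegree_ge (inv_family add_universal Xs) k.+1 ->
  min_semidegree_ge (inv_family D (restrict_sets Xs)) k.
Proof.
move=> deg v; have [out_v in_v] := deg (lift0 v).
by split; [apply: ltn_card_lift0 out_v | apply: ltn_card_lift0 in_v] => w;
  rewrite inv_family_add_universal.
Qed.

End UniversalVertex.

Lemma semicomplete_connected n (D : rel 'I_n) :
  (forall u v, u != v -> D u v || D v u) -> edge_connected n.-1 D.
Proof.
move=> semiD; apply/edge_connectedP/connected_onP => X.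
rewrite separatesT => /andP[X0 X1].
have adjD u v : u != v -> adj [set p | D p.1 p.2] u v.
  by rewrite /adj !inE; exact: semiD.
apply: leq_trans (card_leaving_pairs _ X).
apply: (@leq_trans (#|X| * #|~: X|)).
  have := cardsC X; rewrite card_ord; move: X0 X1; rewrite -!card_gt0.
  by clear; nia.
rewrite -cardsX; apply/subset_leq_card/subsetP => -[u v].
rewrite !inE /= => /andP[uX vX].
by rewrite /leaves /= uX vX andbT adjD //; apply: contraNneq vX => <-.
Qed.

Lemma exists_surjection (aT rT : finType) (A : {set aT}) (B : {set rT}) :
    B != set0 -> #|B| <= #|A| ->
  exists2 f : aT -> rT, {in A, forall x, f x \in B} &
    {in B, forall y, exists2 x, x \in A & f x = y}.
Proof.
case/set0Pn => y0 y0B leBA; have /set0Pn[x0 _] : A != set0.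
  by rewrite -card_gt0 (leq_trans _ leBA) //; apply/card_gt0P; exists y0.
exists (fun x => nth y0 (enum B) (index x (enum A))) => [x _|y yB].
  have [ltB|geB] := ltnP (index x (enum A)) (size (enum B)).
    by have := mem_nth y0 ltB; rewrite mem_enum.
  by rewrite nth_default.
have lt_y : index y (enum B) < size (enum A).
  apply: leq_trans (_ : size (enum B) <= _); last by rewrite -!cardE.
  by rewrite index_mem mem_enum.
exists (nth x0 (enum A) (index y (enum B))); first by rewrite -mem_enum mem_nth.
by rewrite index_uniq ?enum_uniq // nth_index ?mem_enum.
Qed.

Lemma cut_gt1 (T : finType) (E : seq (T * T)) X p q :
    p \in E -> q \in E -> p != q -> crosses X p -> crosses X q ->
  1 < cut E X.
Proof.
move=> pE qE pq pX qX; apply: (@leq_trans (count (crosses X) [:: p; q])).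
  by rewrite /= pX qX.
apply: count_uniq_sub => [|r]; first by rewrite /= inE pq.
by rewrite !inE => /orP[] /eqP ->.
Qed.

Definition ordered_pairs (T : finType) (V : {set T}) : {set T * T} :=
  [set p in setX V V | p.1 != p.2].

Lemma card_ordered_pairs (T : finType) (V : {set T}) :
  #|ordered_pairs V| + #|V| = #|V| * #|V|.
Proof.
rewrite -cardsX -(cardsID [set p : T * T | p.1 == p.2] (setX V V)) addnC.
congr (_ + _); last by apply: eq_card => p; rewrite !inE andbC.
have diag_inj : injective (fun v : T => (v, v)) by move=> u v [].
rewrite -(card_imset _ diag_inj).
apply: eq_card => -[u v]; rewrite !inE /=; apply/imsetP/andP.
  by case=> w wV [-> ->]; rewrite wV eqxx.
by case=> /andP[uV _] /eqP <-; exists u.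
Qed.

Section Attachment.
Variables (n : nat) (V : {set 'I_n}) (anchors : 'I_n -> 'I_n * 'I_n).
Implicit Types (X : {set 'I_n}) (u v w : 'I_n).

Definition attachment : rel 'I_n := fun u w =>
  [&& u \in V, w \notin V & (u == (anchors w).1) || (u == (anchors w).2)].

Hypothesis anchorsP : {in ~: V, forall w, anchors w \in ordered_pairs V}.
Hypothesis anchors_onto : {in ordered_pairs V, forall p,
  exists2 w, w \in ~: V & anchors w = p}.

Lemma attachment_loopless : loopless attachment.
Proof. by move=> v; rewrite /attachment; case: (v \in V). Qed.

Lemma attachment_anchors w : w \notin V ->
  [/\ attachment (anchors w).1 w, attachment (anchors w).2 w &
      (anchors w).1 != (anchors w).2].
Proof.
rewrite -in_setC => wV; have := anchorsP wV; move: wV; rewrite !inE /attachment.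
by move=> -> /andP[/andP[-> ->] ->]; rewrite !eqxx !orbT.
Qed.

Lemma anchors_of u v : u \in V -> v \in V -> u != v ->
  exists2 w, w \notin V & anchors w = (u, v).
Proof.
move=> uV vV uv; have [|w wV anchors_w] := anchors_onto (x := (u, v)).
  by rewrite !inE /= uV vV.
by exists w; rewrite // -in_setC.
Qed.

Lemma attachment_connected : edge_connected 2 attachment.
Proof.
apply/edge_connectedP/connected_onP => X /separatesP[[a _ aX] [b _ bX]].
have arc_into w : w \notin V -> crosses X (anchors w) ->
    exists2 u, (u, w) \in arcs attachment & crosses X (u, w).
  case/attachment_anchors => att1 att2 _ anchors_w.
  have [cross1|cross1] := boolP (crosses X ((anchors w).1, w)).
    by exists (anchors w).1; rewrite ?mem_arcs.
  exists (anchors w).2; rewrite ?mem_arcs //; move: anchors_w cross1.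
  by rewrite /crosses /=; do 3!case: (_ \in X).
have [/existsP[[u v] /and4P[/= uV vV uX vX]]|V_side] :=
    boolP [exists p : 'I_n * 'I_n,
      [&& p.1 \in V, p.2 \in V, p.1 \in X & p.2 \notin X]].
  have uv : u != v by apply: contraNneq vX => <-.
  have [w1 w1V anc1] := anchors_of uV vV uv.
  have [w2 w2V anc2] : exists2 w, w \notin V & anchors w = (v, u).
    by apply: anchors_of; rewrite // eq_sym.
  have [|u1 arc1 cross1] := arc_into w1 w1V.
    by rewrite anc1 /crosses /= uX.
  have [|u2 arc2 cross2] := arc_into w2 w2V.
    by rewrite anc2 /crosses /= uX addbT.
  apply: cut_gt1 arc1 arc2 _ cross1 cross2; apply: contraNneq uv => -[_ eq_w].
  by move: anc1; rewrite eq_w anc2 => -[->].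
have [w wV crossV] : exists2 w, w \notin V & {in V, forall v, crosses X (v, w)}.
  have [/subsetP VX|/subsetPn[v vV vX]] := boolP (V \subset X).
    exists b => [|v /VX vX]; first by apply: contra bX => /VX.
    by rewrite /crosses /= vX (negbTE bX).
  have VX u : u \in V -> u \notin X.
    move=> uV; apply: contra V_side => uX; apply/existsP; exists (u, v).
    by rewrite /= uV vV uX vX.
  exists a => [|u /VX/negbTE uX]; first by apply: contraL aX => /VX.
  by rewrite /crosses /= uX aX.
have [att1 att2 neq12] := attachment_anchors wV.
have /andP[V1 _] := att1; have /andP[V2 _] := att2.
by apply: (@cut_gt1 _ _ _ ((anchors w).1, w) ((anchors w).2, w));
  rewrite ?mem_arcs ?crossV // xpair_eqE negb_and neq12.
Qed.

Section Inversion.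
Variable Xs : seq {set 'I_n}.
Hypothesis deg : min_semidegree_ge (inv_family attachment Xs) 1.

Definition membership v : (size Xs).-tuple bool :=
  map_tuple (fun X : {set 'I_n} => v \in X) (in_tuple Xs).

Lemma eq_shared_count u v w :
  membership u = membership v -> shared_count Xs u w = shared_count Xs v w.
Proof.
move=> /(congr1 val) /= /eq_in_map eq_mem.
by apply: eq_in_count => X /eq_mem ->.
Qed.

Lemma membership_neq0 v : v \in V -> membership v != nseq_tuple _ false.
Proof.
move=> vV; have [_ /card_gt0P[u]] := deg v.
rewrite inE inv_familyE {2}/attachment vV andbF.
case: ifP => // odd_uv _; apply: contraTneq odd_uv => eq0.
have -> : shared_count Xs u v = 0; last by [].
apply/eqP; rewrite -leqn0 leqNgt -has_count; apply/hasPn => X XXs.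
have : (v \in X) \in tval (membership v).
  by apply: (map_f (fun X : {set 'I_n} => v \in X)).
by rewrite eq0 mem_nseq => /andP[_ /eqP ->]; rewrite andbF.
Qed.

(* A vertex anchored at [u] and [v] with equal memberships would have its two
   arcs reversed together, and stay a source or a sink. *)
Lemma membership_inj : {in V &, injective membership}.
Proof.
move=> u v uV vV eq_mem; have [//|uv] := eqVneq u v.
have [w wV anc] := anchors_of uV vV uv.
have odd_anchor y : attachment y w -> shared_count Xs y w = shared_count Xs u w.
  rewrite /attachment anc => /and3P[_ _ /orP[]/eqP ->] //=.
  by rewrite (eq_shared_count w eq_mem).
have no_out y : attachment w y = false by rewrite /attachment (negbTE wV).
have [/card_gt0P[x] + /card_gt0P[y]] := deg w.
rewrite !inE !inv_familyE !no_out [shared_count Xs w x]shared_countC.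
case: ifP => // odd_x att_x; case: ifP => // odd_y att_y.
by move: odd_x odd_y; rewrite !odd_anchor // => ->.
Qed.

Lemma card_sources_lt : #|V| < 2 ^ size Xs.
Proof.
rewrite -(card_in_imset membership_inj) -card_bool -(card_tuple (size Xs)).
rewrite -cardsT; apply/proper_card/properP; split; first exact: subsetT.
exists (nseq_tuple _ false); rewrite ?inE //.
apply/imsetP => -[v /membership_neq0].
by move=> + eq0; rewrite -eq0 eqxx.
Qed.

End Inversion.
End Attachment.

(* In order 3 the square root is 1 and no attachment is available, but the
   transitive tournament is not strong. *)
Lemma exists_hard_base q : 2 < q ->
  exists D : rel 'I_q, [/\ loopless D, edge_connected 2 D &
    forall Xs, min_semidegree_ge (inv_family D Xs) 1 -> q <= 4 ^ size Xs].
Proof.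
move=> q_gt2; have [q_gt3|q_le3] := ltnP 3 q; last first.
  have {q_gt2 q_le3} -> : q = 3 by apply/eqP; rewrite eqn_leq q_le3.
  exists (fun u v => u < v); split=> [v|X|Xs deg].
  - exact: ltnn.
  - by apply: (@semicomplete_connected 3) => u v; rewrite -neq_ltn.
  - case: Xs deg => [|X Xs] deg; last first.
      by rewrite (@leq_trans (4 ^ 1)) // leq_pexp2l.
    have [/card_gt0P[v] + _] := deg ord_max.
    by rewrite inE inv_familyE /= ltnNge -ltnS ltn_ord.
pose m := Nat.sqrt q; have [/leP sqr_m /ltP m_sqr] := PeanoNat.Nat.sqrt_spec' q.
have m_gt1 : 1 < m.
  by rewrite ltnNge; apply/negP => m_le1; move: m_sqr; rewrite -/m; nia.
have m_le_q : m <= q by apply: leq_trans sqr_m; rewrite -/m; nia.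
pose V := [set widen_ord m_le_q i | i : 'I_m].
have card_V : #|V| = m.
  by rewrite card_imset ?card_ord // => i j /(congr1 val) /= /val_inj.
have pairs_le : #|ordered_pairs V| <= #|~: V|.
  have := card_ordered_pairs V; have := cardsC V; rewrite card_ord card_V.
  by move: sqr_m; rewrite -/m; clear; lia.
have pairs_neq0 : ordered_pairs V != set0.
  rewrite -card_gt0; have := card_ordered_pairs V; rewrite card_V.
  by clear - m_gt1; nia.
have [anchors anchorsP anchors_onto] := exists_surjection pairs_neq0 pairs_le.
exists (attachment V anchors); split.
- exact: attachment_loopless.
- exact: attachment_connected.
- move=> Xs /(card_sources_lt anchors_onto); rewrite card_V => m_lt.
  rewrite -[4]/(2 * 2) expnMn; apply: leq_trans (leq_mul m_lt m_lt).
  exact: ltnW.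
Qed.

Lemma exists_hard_digraph p q : 2 < q ->
  exists D : rel 'I_(p + q), [/\ loopless D, edge_connected (2 * p.+1) D &
    forall Xs, min_semidegree_ge (inv_family D Xs) p.+1 -> q <= 4 ^ size Xs].
Proof.
move=> q_gt2; elim: p => [|p [D [D_irr conD hardD]]].
  exact: exists_hard_base.
exists (add_universal D); split.
- exact: add_universal_loopless.
- by apply: add_universal_connected conD; clear - q_gt2; lia.
- move=> Xs /min_semidegree_add_universal/hardD; rewrite size_map; apply.
Qed.

Lemma inversion_lower_bound n k : 0 < k -> k + 2 <= n ->
  exists D : rel 'I_n, [/\ loopless D, edge_connected (2 * k) D &
    forall Xs, arc_strong k (inv_family D Xs) -> n - k + 1 <= 4 ^ size Xs].
Proof.
case: k => // p _ pn; have -> : n = p + (n - p) by lia.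
have [|D [D_irr conD hardD]] := @exists_hard_digraph p (n - p); first by lia.
exists D; split=> // Xs strong; have -> : p + (n - p) - p.+1 + 1 = n - p by lia.
by apply/hardD/arc_strong_min_semidegree; first by lia.
Qed.

(** * Extremal inversion numbers *)

Lemma exists_sinv n k (D : rel 'I_n) :
    (exists Xs : seq {set 'I_n}, arc_strong k (inv_family D Xs)) ->
  exists s, is_sinv_digraph k D s.
Proof.
case=> Ys strongYs.
pose reached s := `[< exists Xs : seq {set 'I_n},
  size Xs = s /\ arc_strong k (inv_family D Xs) >].
have exists_reached : exists s, reached s.
  by exists (size Ys); apply/asboolP; exists Ys.
case: (ex_minnP exists_reached) => s /asboolP reach_s min_s.
exists s; split=> // Xs strongXs.
by apply: min_s; apply/asboolP; exists Xs.
Qed.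

Lemma exists_sinv_order n k b (D0 : rel 'I_n) :
    loopless D0 -> edge_connected (2 * k) D0 ->
    (forall D : rel 'I_n, loopless D -> edge_connected (2 * k) D ->
       exists2 Xs : seq {set 'I_n},
         size Xs <= b & arc_strong k (inv_family D Xs)) ->
  exists s, [/\ is_sinv_order k n s, s <= b &
    exists2 Xs : seq {set 'I_n},
      size Xs <= s & arc_strong k (inv_family D0 Xs)].
Proof.
move=> D0_irr conD0 reach_b.
have sinvP (D : rel 'I_n) : loopless D -> edge_connected (2 * k) D ->
    exists s, is_sinv_digraph k D s.
  move=> D_irr conD; have [Xs _ strongXs] := reach_b D D_irr conD.
  by apply: exists_sinv; exists Xs.
pose attained s := `[< exists D : rel 'I_n,
  loopless D /\ edge_connected (2 * k) D /\ is_sinv_digraph k D s >].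
have [t sinv_t] := sinvP D0 D0_irr conD0.
have exists_attained : exists s, attained s.
  by exists t; apply/asboolP; exists D0.
have attained_le s : attained s -> s <= b.
  case/asboolP=> D [D_irr [conD [_ min_s]]].
  by have [Xs size_Xs /min_s/leq_trans] := reach_b D D_irr conD; apply.
case: (ex_maxnP exists_attained attained_le) => s att_s max_s; exists s; split.
- split=> [D D_irr conD|]; last exact/asboolP.
  have [r sinv_r] := sinvP D D_irr conD; exists r; split=> //.
  by apply: max_s; apply/asboolP; exists D.
- exact: attained_le.
- have [[Xs [size_Xs strongXs]] _] := sinv_t; exists Xs => //.
  by rewrite size_Xs max_s //; apply/asboolP; exists D0.
Qed.

Lemma ln2_gt0 : Rlt 0 (ln 2).
Proof. by rewrite -ln_1; apply: ln_increasing; lra. Qed.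

Lemma log2_exp2 s : log2 (INR (2 ^ s)) = INR s.
Proof.
have ln2_neq0 := Rgt_not_eq _ _ ln2_gt0.
elim: s => [|s IH]; first by rewrite /log2 ln_1 /Rdiv Rmult_0_l.
have pow_gt0 : Rlt 0 (INR (2 ^ s)) by apply/lt_0_INR/ltP; rewrite expn_gt0.
have -> : INR (2 ^ s.+1) = Rmult 2 (INR (2 ^ s)) by rewrite expnS mult_INR.
by rewrite S_INR -IH /log2 ln_mult //; [field | lra].
Qed.

Lemma log2_leq a b : 0 < a -> a <= b -> Rle (log2 (INR a)) (log2 (INR b)).
Proof.
move=> a_gt0 /leP/le_INR ab; apply: Rmult_le_compat_r.
  by left; apply: Rinv_0_lt_compat ln2_gt0.
case: ab => [lt_ab|->]; last by right.
by left; apply: ln_increasing => //; apply/lt_0_INR/ltP.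
Qed.

Theorem theorem1p1 (k n : nat) (hk : 0 < k) (hn : k + 2 <= n) :
  exists s : nat, is_sinv_order k n s /\
    Rle (Rdiv (log2 (INR (n - k + 1))) (IZR 2%Z)) (INR s) /\
    Rle (INR s) (Rminus (Rplus (log2 (INR n)) (Rmult (IZR 4%Z) (INR k))) (IZR 3%Z)).
Proof.
have [D [D_irr conD hardD]] := inversion_lower_bound hk hn.
have [s [sinv_s s_le [Xs size_Xs /hardD q_le]]] :=
  exists_sinv_order D_irr conD (fun D' => inversion_upper_bound hk hn).
exists s; split=> //; split.
- have q_gt0 : 0 < n - k + 1 by rewrite addn1.
  have {}q_le : n - k + 1 <= 2 ^ (2 * s).
    by rewrite expnM; apply: leq_trans q_le _; rewrite leq_pexp2l.
  by have := log2_leq q_gt0 q_le; rewrite log2_exp2 mult_INR /=; lra.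
- have n_gt0 : 0 < n by lia.
  have := log2_leq (_ : 0 < 2 ^ trunc_log 2 n) (@trunc_logP 2 n isT n_gt0).
  rewrite expn_gt0 log2_exp2 => /(_ isT).
  have : s + 3 <= trunc_log 2 n + 4 * k by clear - s_le hk; lia.
  move=> /leP/le_INR.
  by rewrite (plus_INR s 3) (plus_INR _ (4 * k)) (mult_INR 4 k) /=; lra.
Qed.
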